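(* Let $G=(V,E)$ be a finite connected simple undirected graph, $uv\notin E$ with $u\neq v$, and $s\in V$. Then the limit $$\ell_s:=\lim_{\lambda\to\infty}\frac{f_s(\lambda)-f_s(0)}{\lambda}$$ exists and $$\ell_s=\frac{2}{d_u+d_v}\,\mathbb E_{\bar s}^{\bar G}L_w\ \ge 0 .$$ Moreover: 1. if $s\in\{u,v\}$, then $\ell_s>0$; 2. if $s\notin\{u,v\}$, then $\ell_s=0$ if and only if the underlying simple graph of $\bar G$ is a path whose endpoints are $s$ and $w$; 3. in terms of $G$, the case $\ell_s=0$ occurs exactly when, for some $L\ge0$, $V=\{x_0,x_1,\dots,x_L,u,v\}$ (these $L+3$ vertices being distinct), with $s=x_0$, $c:=x_L$, and $E=\{x_{i-1}x_i:1\le i\le L\}\cup\{cu,cv\}$; that is, $G$ is a path with $L$ edges from $s$ to $c$ together with two pendant leaves $u,v$ attached at $c$, and no other vertices or edges.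
   Context: For $\lambda\ge0$, give every edge of $G$ conductance $1$ and add the edge $uv$ with conductance $\lambda$; the random walk moves along an incident edge with probability proportional to its conductance. $f_s(\lambda)$ is the expected cover time of this walk started at $s$ (expected first time at which all vertices have been visited, the start being visited at time $0$). $d_u,d_v$ are degrees in $G$. $\bar G=G/uv$ is the multigraph obtained from $G$ by identifying $u$ and $v$ to one vertex $w$, retaining parallel edges (so $w$ has degree $d_u+d_v$); $\bar s$ is the image of $s$ in $\bar G$. $(Y_t)$ is simple random walk on the multigraph $\bar G$ (each parallel edge is chosen with equal probability, so neighbours are weighted by multiplicity), $\bar\tau_{\rm cov}$ is its cover time, and $$L_w=\sum_{t=0}^{\bar\tau_{\rm cov}-1}\mathbf 1_{\{Y_t=w\}}$$ is the number of visits to $w$ strictly before the cover time. $\mathbb E_{\bar s}^{\bar G}$ is expectation for this walk started at $\bar s$. *)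

(* Defs.v *)
From HB Require Import structures.
From mathcomp Require Import all_boot all_order all_algebra.
From mathcomp Require Import all_classical all_reals all_analysis.
Set Implicit Arguments.
Unset Strict Implicit.
Unset Printing Implicit Defensive.
Import Order.TTheory GRing.Theory Num.Theory.
Import numFieldNormedType.Exports.

Local Open Scope ring_scope.

(* A finite simple graph on V is a symmetric irreflexive e : rel V. *)

Definition degree (V : finType) (e : rel V) (x : V) : nat := #|[set y | e x y]%SET|.

Definition edge_set (V : finType) (e : rel V) : {set {set V}} :=
  [set [set p.1; p.2]%SET | p : V * V & e p.1 p.2]%SET.

Definition path_graph_between (T : finType) (e : rel T) (a b : T) : Prop :=
  exists (n : nat) (x : 'I_n.+1 -> T),
    [/\ bijective x, x ord0 = a, x ord_max = b &
      forall i j : 'I_n.+1,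
        e (x i) (x j) = ((j == i.+1 :> nat) || (i == j.+1 :> nat))].

Definition conductance (R : realType) (V : finType) (e : rel V) (u v : V)
    (lam : R) (x y : V) : R :=
  (e x y)%:R + lam * ([set x; y]%SET == [set u; v]%SET)%:R.

(* Vertices of G/uv: Some x for each x outside {u, v}, and None for the vertex
   obtained by merging u and v. *)
Definition identified (V : finType) (u v : V) : finType :=
  option {x : V | x \notin [:: u; v]}.

Definition identify (V : finType) (u v : V) (x : V) : identified u v :=
  insub x.

Definition merged (V : finType) (u v : V) : identified u v := None.

(* Multiplicity of the edge ab in G/uv. Each edge of G is seen as two ordered
   pairs, so a loop at a would be counted twice on the diagonal; when u and v
   are not adjacent there are no loops. *)
Definition multiplicity (V : finType) (e : rel V) (u v : V)
    (a b : identified u v) : nat :=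
  #|[set p : V * V |
      [&& e p.1 p.2, identify u v p.1 == a & identify u v p.2 == b]]%SET|.

Definition underlying_simple (V : finType) (e : rel V) (u v : V) :
    rel (identified u v) :=
  fun a b => (a != b) && (0 < multiplicity e a b)%N.

Definition transition (R : realType) (T : finType) (c : T -> T -> R) (x y : T) : R :=
  c x y / \sum_(z : T) c x z.

Local Open Scope classical_set_scope.
Local Open Scope ereal_scope.

Definition random_walk (R : realType) (d : measure_display)
    (Om : measurableType d) (P : probability Om R) (T : finType)
    (c : T -> T -> R) (s : T) (X : nat -> Om -> T) : Prop :=
  [/\ forall t x, measurable (X t @^-1` [set x]),
      P (X 0%N @^-1` [set s]) = 1 &
      forall (t : nat) (x : nat -> T),
        P [set om | forall i, (i <= t.+1)%N -> X i om = x i] =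
        P [set om | forall i, (i <= t)%N -> X i om = x i] *
          (transition c (x t) (x t.+1))%:E].

(* The infimum over the empty set is +oo. *)
Definition cover_time (R : realType) (Om : Type) (T : finType)
    (X : nat -> Om -> T) (om : Om) : \bar R :=
  ereal_inf [set (t%:R)%:E |
    t in [set t : nat | forall x, exists2 i, (i <= t)%N & X i om = x]].

Definition visits_before_cover (R : realType) (Om : Type) (T : finType)
    (X : nat -> Om -> T) (w : T) (om : Om) : \bar R :=
  \sum_(0 <= t <oo | ((t%:R)%:E < cover_time R X om) && (X t om == w)) 1.

(* random_walk is inhabited as soon as no vertex is isolated: a walk is coded
   in a uniform r in [0, 1[ by nested subintervals. piece h is the lower end
   and the length of the subinterval of the path h, most recent vertex first. *)
Module WalkExistence.
Local Close Scope ereal_scope.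
Local Open Scope ring_scope.

Section existence.
Context (R : realType) (T : finType) (q : seq T -> T -> R).
Context (q_ge0 : forall h y, 0 <= q h y) (q_sum : forall h, \sum_y q h y = 1).

Definition cumul h (k : nat) : R := \sum_(z | (enum_rank z < k)%N) q h z.

Lemma cumul0 h : cumul h 0 = 0.
Proof. by rewrite /cumul big_pred0. Qed.

Lemma cumulT h : cumul h #|T| = 1.
Proof. by rewrite -(q_sum h) /cumul; apply: eq_bigl => z; rewrite ltn_ord. Qed.

Lemma cumulS h y : cumul h (enum_rank y).+1 = cumul h (enum_rank y) + q h y.
Proof.
rewrite /cumul (bigD1 y) //= addrC; congr (_ + _); apply: eq_bigl => z.
by rewrite ltnS -(inj_eq enum_rank_inj) ltn_neqAle andbC.
Qed.

Lemma cumul_le h j k : (j <= k)%N -> cumul h j <= cumul h k.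
Proof.
move=> jk; rewrite /cumul [leRHS](bigID (fun z => (enum_rank z < j)%N)) /=.
rewrite [X in _ <= X + _](_ : _ = cumul h j).
  by rewrite lerDl sumr_ge0.
apply: eq_bigl => z; case: (ltnP _ j) => zj; rewrite ?andbF//.
by rewrite andbT (leq_trans zj jk).
Qed.

Fixpoint piece (h : seq T) : R * R :=
  if h is y :: h' then
    let: (lo, len) := piece h' in
    (lo + len * cumul h' (enum_rank y), len * q h' y)
  else (0, 1).

Definition in_piece (r : R) h := (piece h).1 <= r < (piece h).1 + (piece h).2.

Lemma piece_ge0 h : 0 <= (piece h).1 /\ 0 <= (piece h).2.
Proof.
elim: h => [|y h] /=; first by split.
case: (piece h) => lo len /= [lo0 len0]; split; last by rewrite mulr_ge0.
by rewrite addr_ge0// mulr_ge0// /cumul sumr_ge0.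
Qed.

Lemma in_pieceS r y h : in_piece r (y :: h) -> in_piece r h.
Proof.
rewrite /in_piece /=; have := piece_ge0 h; case: (piece h) => lo len /= [_ len0].
case/andP => h1 h2; apply/andP; split.
  by apply: le_trans h1; rewrite lerDl mulr_ge0// /cumul sumr_ge0.
apply: lt_le_trans h2 _; rewrite -addrA -mulrDr -cumulS lerD2l ler_piMr//.
by rewrite -(cumulT h) cumul_le.
Qed.

Lemma piece_le1 h : (piece h).1 + (piece h).2 <= 1.
Proof.
elim: h => [|y h] /=; first by rewrite add0r.
have := piece_ge0 h; case: (piece h) => lo len /= [_ len0]; apply: le_trans.
rewrite -addrA -mulrDr -cumulS lerD2l ler_piMr//.
by rewrite -(cumulT h) cumul_le.
Qed.

Lemma in_piece_ex r h : in_piece r h -> exists y, in_piece r (y :: h).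
Proof.
rewrite /in_piece /=; have := piece_ge0 h; case: (piece h) => lo len /= [_ len0].
move=> /andP[h1 h2].
have ex : exists k, r < lo + len * cumul h k by exists #|T|; rewrite cumulT mulr1.
case: (ex_minnP ex) => -[|k]; first by rewrite cumul0 mulr0 addr0 ltNge h1.
move=> rk mink.
have kT : (k < #|T|)%N by apply: mink; rewrite cumulT mulr1.
exists (enum_val (Ordinal kT)).
rewrite -addrA -mulrDr -cumulS enum_valK /= rk andbT leNgt.
by apply/negP => /mink; rewrite ltnn.
Qed.

Lemma in_piece_uniq r h y z : in_piece r (y :: h) -> in_piece r (z :: h) -> y = z.
Proof.
wlog yz : y z / (enum_rank y <= enum_rank z)%N.
  move=> W; case/orP: (leq_total (enum_rank y) (enum_rank z)) => le1 hy hz.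
    exact: W.
  by apply/esym; apply: W.
move: yz; rewrite leq_eqVlt => /orP[/eqP/val_inj/enum_rank_inj//|yz].
rewrite /in_piece /=; have := piece_ge0 h; case: (piece h) => lo len /= [_ len0].
rewrite -!addrA -!mulrDr -!cumulS => /andP[_ h1] /andP[h2 _].
have : lo + len * cumul h (enum_rank z) < lo + len * cumul h (enum_rank y).+1.
  exact: le_lt_trans h2 h1.
by rewrite ltrD2l ltNge ler_wpM2l// cumul_le.
Qed.

Context (x0 : T).

Definition next h (r : R) : T := odflt x0 [pick y | in_piece r (y :: h)].

Fixpoint history t (r : R) : seq T :=
  if t is t'.+1 then next (history t' r) r :: history t' r else [::].

Lemma size_history t r : size (history t r) = t.
Proof. by elim: t => //= t ->. Qed.

Lemma history_piece t r h : 0 <= r < 1 -> size h = t ->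
  history t r = h <-> in_piece r h.
Proof.
move=> r01; elim: t h => [|t IH] [|y h]//=.
  by rewrite /in_piece /= add0r r01.
case=> sh; split.
  case=> <- Hh; rewrite Hh; move/(IH h sh): Hh => /in_piece_ex [z hz].
  by rewrite /next; case: pickP => [//|/(_ z)]; rewrite hz.
move=> hy; have Hh := in_pieceS hy; move/(IH h sh): Hh => ->; congr (_ :: _).
rewrite /next; case: pickP => [z hz|/(_ y)]; last by rewrite hy.
exact: in_piece_uniq hz hy.
Qed.

Let Om := measurableTypeR R.

Lemma measurable_in_piece h : measurable [set r : Om | in_piece r h].
Proof.
rewrite (_ : [set _ | _] = `[(piece h).1, (piece h).1 + (piece h).2[%classic); first exact: measurable_itv.
by apply/seteqP; split => r /=; rewrite in_itv.
Qed.

Lemma measurable_next h y : measurable [set r : Om | next h r = y].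
Proof.
rewrite (_ : [set _ | _] = \bigcup_(b in [set b : {ffun T -> bool} | odflt x0 [pick z | b z] = y])
   \bigcap_(z in [set: T]) [set r : Om | in_piece r (z :: h) = b z]).
  apply: fin_bigcup_measurable; first exact: finite_finset.
  move=> b _; apply: fin_bigcap_measurable; [exact: finite_finset|move=> z _].
  case: (b z); first exact: measurable_in_piece.
  rewrite (_ : [set _ | _] = ~` [set r : Om | in_piece r (z :: h)]).
    by apply: measurableC; exact: measurable_in_piece.
  by apply/seteqP; split => r /=; [move=> ->|move/negP/negbTE].
apply/seteqP; split => r /=.
  move=> <-; exists [ffun z => in_piece r (z :: h)].
    by rewrite /= /next; congr odflt; apply: eq_pick => z; rewrite ffunE.
  by move=> z _ /=; rewrite ffunE.
case=> b <- br; rewrite /next; congr odflt; apply: eq_pick => z.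
by rewrite (br z).
Qed.

Lemma measurable_history t h : measurable [set r : Om | history t r = h].
Proof.
elim: t h => [|t IH] h /=.
  case: h => [|y h].
    by rewrite (_ : [set _ | _] = setT)//; apply/seteqP; split.
  by rewrite (_ : [set _ | _] = set0)//; apply/seteqP; split.
case: h => [|y h]; first by rewrite (_ : [set _ | _] = set0)//; apply/seteqP; split.
rewrite (_ : [set _ | _] = [set r : Om | next h r = y] `&` [set r : Om | history t r = h]).
  by apply: measurableI => //; exact: measurable_next.
apply/seteqP; split => r /=; first by case=> <- ->.
by case=> <- ->.
Qed.

Definition coded_walk t (r : Om) : T := head x0 (history t.+1 r).

Lemma measurable_coded_walk t x : measurable (coded_walk t @^-1` [set x]).
Proof.
rewrite (_ : _ @^-1` _ =
   \bigcup_(h in [set h : t.+1.-tuple T | head x0 h = x]) [set r : Om | history t.+1 r = h]).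
  apply: fin_bigcup_measurable; first exact: finite_finset.
  by move=> h _; exact: measurable_history.
apply/seteqP; split => r /=; first by move=> <-; exists (Tuple (introT eqP (size_history t.+1 r))).
by case=> h <- /= <-.
Qed.

Lemma history_walk t (x : nat -> T) r :
  (forall i, (i <= t)%N -> coded_walk i r = x i) <->
  history t.+1 r = rev (mkseq x t.+1).
Proof.
elim: t => [|t IH].
  rewrite /mkseq /=; split => [/(_ 0%N isT) <-//|[H] [|//] _].
  by rewrite -H.
rewrite mkseqS rev_rcons.
split.
  move=> H; have := H t.+1 (leqnn _).
  rewrite {1}/coded_walk /= => <-; congr (_ :: _).
  by apply/IH => i it; apply: H; exact: leqW.
move=> [H1 H2] i; rewrite leq_eqVlt => /orP[/eqP->|]; first by rewrite /coded_walk /= H1.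
by move: i; apply/IH; rewrite -[RHS]H2.
Qed.

Lemma uniform_itv (a b : R) : 0 <= a -> a <= b -> b <= 1 ->
  uniform_prob (@ltr01 R) `[a, b[%classic = (b - a)%:E.
Proof.
move=> a0 ab b1; rewrite /uniform_prob.
rewrite (eq_integral (fun=> 1%E)); last first.
  move=> r; rewrite inE /= in_itv /= => /andP[ar rb]; rewrite /uniform_pdf.
  by rewrite (le_trans a0 ar) (ltW (lt_le_trans rb b1)) /= subr0 invr1.
rewrite integral_cst//= mul1e lebesgue_measure_itv /= lte_fin.
by case: ltP => // ba; rewrite (le_anti (introT andP (conj ab ba))) subrr.
Qed.

Lemma uniform01 (A : set Om) : measurable A ->
  uniform_prob (@ltr01 R) A = uniform_prob (@ltr01 R) (A `&` `[0, 1[%classic).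
Proof.
move=> mA.
have E : uniform_prob (@ltr01 R) (A `&` `[0, 1[%classic) = uniform_prob (@ltr01 R) A; last by rewrite E.
have H : uniform_prob (@ltr01 R) (~` `[0, 1[%classic) = 0%E.
  have U : uniform_prob (@ltr01 R) `[0, 1[%classic = 1%E by rewrite uniform_itv// subr0.
  apply: etrans (probability_setC _ _) _ => //.
  by apply: etrans (congr1 (fun z => 1 - z)%E U) _; rewrite subee.
apply/eqP; rewrite eq_le; apply/andP; split.
  by apply: le_measure; rewrite ?inE//; exact: measurableI.
rewrite -[X in (uniform_prob _ X <= _)%E](setIT A) -(setUv `[0, 1[%classic) setIUr.
apply: le_trans (measureU2 _ _ _) _.
- exact: measurableI.
- by apply: measurableI => //; exact: measurableC.
rewrite -[leRHS]adde0 leeD2l//.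
rewrite -H; apply: le_measure; rewrite ?inE//.
  by apply: measurableI => //; exact: measurableC.
exact: measurableC.
Qed.

Lemma prob_history h :
  uniform_prob (@ltr01 R) [set r : Om | history (size h) r = h] = (piece h).2%:E.
Proof.
rewrite uniform01; last exact: measurable_history.
rewrite (_ : _ `&` _ = `[(piece h).1, (piece h).1 + (piece h).2[%classic).
  have [h1 h2] := piece_ge0 h.
  by rewrite uniform_itv// ?lerDl// ?piece_le1// addrAC subrr add0r.
have [l1 _] := piece_ge0 h.
apply/seteqP; split => r /=; rewrite !in_itv /=.
  by case=> H r01; apply/(history_piece r01 erefl).
move=> hr; have r01 : 0 <= r < 1.
  case/andP: hr => a b; rewrite (le_trans l1 a)/=.
  exact: lt_le_trans b (piece_le1 h).
by split=> //; apply/(history_piece r01 erefl).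
Qed.

End existence.

Lemma random_walk_exists (R : realType) (T : finType) (c : T -> T -> R) (s : T) :
  (forall x y, 0 <= c x y) -> (forall x, 0 < \sum_y c x y) ->
  exists (d : measure_display) (Om : measurableType d) (P : probability Om R)
    (X : nat -> Om -> T), random_walk P c s X.
Proof.
move=> c0 cs.
pose q (h : seq T) y := if h is x :: _ then transition c x y else (y == s)%:R.
have q0 h y : 0 <= q h y.
  by case: h => [|x h] /=; [exact: ler0n|rewrite divr_ge0// ltW].
have q1 h : \sum_y q h y = 1.
  case: h => [|x h] /=; last by rewrite -mulr_suml divff// gt_eqF.
  rewrite (bigD1 s)//= eqxx big1 ?addr0// => y /negbTE -> //.
exists _, (measurableTypeR R), (uniform_prob (@ltr01 R)), (coded_walk q s).
have W t x : uniform_prob (@ltr01 R)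
    [set r | forall i, (i <= t)%N -> coded_walk q s i r = x i] =
    (piece q (rev (mkseq x t.+1))).2%:E.
  rewrite -(prob_history q0 q1 s) size_rev size_mkseq; congr uniform_prob.
  by apply/seteqP; split => r /= /history_walk.
split.
- by move=> t x; exact: measurable_coded_walk.
- have := W 0%N (fun=> s); rewrite /= mul1r eqxx => <-; congr uniform_prob.
  apply/seteqP; split => r /=; first by move=> H [|//].
  by move/(_ 0%N isT).
- move=> t x; apply: etrans (W t.+1 x) _.
  apply: etrans; last exact: (congr1 (fun z => z * _)%E (esym (W t x))).
  rewrite mkseqS rev_rcons mkseqS rev_rcons -EFinM; congr (_%:E).
  by move: (rev _) => h /=; case: (piece q h).
Qed.

End WalkExistence.

(* Main.v *)
(** The pairs (S, x) of a visited set and a current position form a Markov chain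
    on which expected costs accumulated before covering solve a Dirichlet problem
    for [cover_laplacian]. This operator satisfies a maximum principle, because by
    connectedness S must eventually grow.

    Let K be the solution on G/uv whose Laplacian is 2 at w and 0 elsewhere, so
    that K = 2 / (d_u + d_v) E L_w. Pull lam K back to G and add a bounded
    correction at u, which sends current through the heavy edge uv so that u and v
    each carry the charge lam instead of an uneven splitting of 2 lam. The result
    has the same Laplacian as the expected cover time up to an error bounded
    uniformly in lam; comparison with barriers gives f(lam) = lam K + O(1).

    Finally K vanishes at the start iff every path of G/uv from the start to w
    visits all vertices, which forces G/uv to be a path. *)
From HB Require Import structures.
Require Import Defs.
From mathcomp Require Import all_boot all_order all_algebra.
From mathcomp Require Import all_classical all_reals all_analysis.
From mathcomp Require Import measurable_realfun zify ring lra.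
Set Implicit Arguments.
Unset Strict Implicit.
Unset Printing Implicit Defensive.
Import Order.TTheory GRing.Theory Num.Theory.
Import numFieldNormedType.Exports.
Local Open Scope ring_scope.

(** * The Dirichlet problem for the chain of visited sets and positions *)

Section CoverChain.
Import boot.fintype boot.finset.
Context (R : realFieldType) (T : finType) (c : T -> T -> R).

(** Minus the generator of the chain, multiplied by the total conductance at [x]; a cost of one per
    step thus appears as the source [\sum_y c x y]. *)
Definition cover_laplacian (F : {set T} -> T -> R) (S : {set T}) (x : T) : R :=
  \sum_y c x y * (F S x - F (y |: S) y).

Lemma cover_laplacianD (F G : {set T} -> T -> R) S x :
  cover_laplacian (fun S x => F S x + G S x) S x =
  cover_laplacian F S x + cover_laplacian G S x.
Proof. by rewrite -big_split; apply: eq_bigr => y _ /=; ring. Qed.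

Lemma cover_laplacianZ (k : R) (F : {set T} -> T -> R) S x :
  cover_laplacian (fun S x => k * F S x) S x = k * cover_laplacian F S x.
Proof. by rewrite mulr_sumr; apply: eq_bigr => y _ /=; ring. Qed.

Lemma cover_laplacian_cst (k : R) S x :
  cover_laplacian (fun _ _ => k) S x = 0.
Proof. by apply: big1 => y _; rewrite subrr mulr0. Qed.

Hypothesis c_ge0 : forall x y, 0 <= c x y.
Hypothesis c_conn : forall x y, connect (fun x y => 0 < c x y) x y.

Lemma closed_full (A : pred T) (x : T) :
  A x -> (forall z y, A z -> 0 < c z y -> A y) -> forall y, A y.
Proof.
move=> Ax Acl y; have /connectP[p pp ->] := c_conn x y.
elim: p x Ax pp => //= z p IH x Ax /andP[xz]; apply: IH; exact: Acl xz.
Qed.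

(* A positive maximum over x of F S x propagates along all edges that stay in S,
   and no edge can leave S by induction on the complement; hence S is full. *)
Lemma cover_max_principle (D : pred {set T}) (F : {set T} -> T -> R) :
  (forall S x y, D S -> x \in S -> 0 < c x y -> D (y |: S)) ->
  (forall S x, D S -> x \in S ->
     F S x <= 0 \/ S != setT /\ cover_laplacian F S x <= 0) ->
  forall S x, D S -> x \in S -> F S x <= 0.
Proof.
move=> Dcl FL S; have [n] := ubnP #|~: S|; elim: n S => // n IH S Sn x DS xS.
rewrite leNgt; apply/negP => Fx.
have [x0 x0S x0max] : exists2 x0, x0 \in S & forall y, y \in S -> F S y <= F S x0.
  by case: (@arg_maxP _ _ _ x (mem S) (F S) xS) => x0 *; exists x0.
have F0 : 0 < F S x0 by apply: lt_le_trans Fx _; exact: x0max.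
have Fout z y : z \in S -> 0 < c z y -> y \notin S -> F (y |: S) y <= 0.
  move=> zS czy yS; apply: IH; [|exact: Dcl czy|exact: setU11].
  rewrite -ltnS; apply: leq_trans Sn; rewrite ltnS; apply: proper_card.
  apply/properP; split; first by rewrite setCS subsetUr.
  by exists y; rewrite !inE ?eqxx.
have Fle z y : z \in S -> 0 < c z y -> F (y |: S) y <= F S x0.
  move=> zS czy; have [yS|yS] := boolP (y \in S).
    by rewrite (setUidPr _) ?sub1set//; exact: x0max.
  exact: le_trans (Fout _ _ zS czy yS) (ltW F0).
have Lle z : z \in S -> F S z = F S x0 -> S != setT /\ cover_laplacian F S z <= 0.
  by move=> zS Fz; have [|//] := FL S z DS zS; rewrite Fz leNgt F0.
have [ST _] := Lle _ x0S erefl.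
case/negP: (ST); apply/eqP/setP => y; rewrite in_setT.
pose A := [pred z | (z \in S) && (F S z == F S x0)].
suff /andP[] : A y by [].
apply: (@closed_full A x0); first by rewrite /= x0S eqxx.
move=> z {}y /andP[zS /eqP Fz] czy; have [_ Lz] := Lle _ zS Fz.
have t_ge0 y' : 0 <= c z y' * (F S z - F (y' |: S) y').
  have := c_ge0 z y'; rewrite le_eqVlt => /orP[/eqP <-|czy'].
    by rewrite mul0r.
  by rewrite mulr_ge0// subr_ge0 Fz; exact: Fle czy'.
have L0 : cover_laplacian F S z = 0.
  by apply/eqP; rewrite eq_le Lz/=; exact: sumr_ge0.
have /(_ y isT)/eqP := psumr_eq0P (fun y' _ => t_ge0 y') L0.
rewrite mulf_eq0 gt_eqF//= subr_eq0 Fz => /eqP Fy.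
have yS : y \in S by apply: contraLR F0 => /(Fout _ _ zS czy); rewrite -Fy leNgt.
by rewrite /= yS Fy (setUidPr _) ?sub1set ?eqxx.
Qed.

Lemma cover_comparison (F G : {set T} -> T -> R) :
  (forall x, F setT x <= G setT x) ->
  (forall (S : {set T}) x, S != setT -> x \in S ->
     cover_laplacian F S x <= cover_laplacian G S x) ->
  forall (S : {set T}) x, x \in S -> F S x <= G S x.
Proof.
move=> FT FL S x xS; rewrite -subr_le0.
apply: (@cover_max_principle predT (fun S x => F S x - G S x)) => // {x xS}S x _ xS.
have [->|ST] := eqVneq S setT; first by left; rewrite subr_le0.
right; split=> //; rewrite [leLHS](_ : _ =
  cover_laplacian F S x - cover_laplacian G S x) ?subr_le0 ?FL//.
by rewrite /cover_laplacian -sumrB; apply: eq_bigr => y _; ring.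
Qed.

Local Notation state := ({set T} * T)%type.

(* The identity at the boundary and at the junk states with x outside S makes the
   operator injective, hence onto, on the space of all functions. *)
Definition dirichlet_op (f : {ffun state -> R^o}) : {ffun state -> R^o} :=
  [ffun z : state => if (z.1 != setT) && (z.2 \in z.1) then
    cover_laplacian (fun S x => f (S, x)) z.1 z.2 else f z].

Lemma dirichlet_op_is_linear : linear dirichlet_op.
Proof.
move=> a f g; apply/ffunP => -[S x]; rewrite !ffunE /=; case: ifP => // _.
rewrite /cover_laplacian scaler_sumr -big_split /=; apply: eq_bigr => y _.
by rewrite !ffunE /GRing.scale /=; ring.
Qed.

HB.instance Definition _ :=
  GRing.isLinear.Build R {ffun state -> R^o} {ffun state -> R^o} _
    dirichlet_op dirichlet_op_is_linear.

Lemma cover_solution_exists (r : {set T} -> T -> R) :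
  exists F : {set T} -> T -> R, (forall x, F setT x = 0) /\
    forall (S : {set T}) x, S != setT -> x \in S -> cover_laplacian F S x = r S x.
Proof.
pose A := linfun dirichlet_op.
(* A kernel element has zero Laplacian and zero boundary values, so comparison with 0 in both
   directions kills it; in finite dimension [A] is then invertible. *)
have Aker : lker A == 0%VS.
  apply/eqP/vspaceP => f; rewrite memv_ker memv0 lfunE /=.
  apply/eqP/eqP => [/ffunP Af|->]; last by rewrite linear0.
  have Afz S x : S != setT -> x \in S -> cover_laplacian (fun S x => f (S, x)) S x = 0.
    by move=> ST xS; have := Af (S, x); rewrite !ffunE /= ST xS.
  have f0 S x : ~~ ((S != setT) && (x \in S)) -> f (S, x) = 0.
    by move=> /negbTE h; have := Af (S, x); rewrite !ffunE /= h.
  have fT x : f (setT, x) = 0 by apply: f0; rewrite eqxx.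
  have L0 S x : cover_laplacian (fun=> fun=> 0) S x = 0.
    by rewrite /cover_laplacian big1// => y _; rewrite subrr mulr0.
  apply/ffunP => -[S x]; rewrite ffunE.
  have [xS|xS] := boolP (x \in S); last by apply: f0; rewrite (negbTE xS) andbF.
  apply/eqP; rewrite eq_le; apply/andP; split.
    apply: (@cover_comparison (fun S x => f (S, x)) (fun=> fun=> 0)) => //.
      by move=> y; rewrite fT.
    by move=> S' y S'T yS'; rewrite Afz// L0.
  apply: (@cover_comparison (fun=> fun=> 0) (fun S x => f (S, x))) => //.
    by move=> y; rewrite fT.
  by move=> S' y S'T yS'; rewrite Afz// L0.
(* Extending the source by 0 prescribes zero boundary values. *)
pose b : {ffun state -> R^o} := [ffun z : state =>
  if (z.1 != setT) && (z.2 \in z.1) then r z.1 z.2 else 0].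
have /ffunP Ab : A ((A^-1)%VF b) = b by rewrite lker0_lfunVK.
exists (fun S x => ((A^-1)%VF b) (S, x)); split=> [x|S x ST xS].
  by have := Ab (setT, x); rewrite lfunE /= !ffunE /= eqxx.
by have := Ab (S, x); rewrite lfunE /= !ffunE /= ST xS.
Qed.

Lemma cover_solution_ge0 (F : {set T} -> T -> R) :
  (forall x, F setT x = 0) ->
  (forall (S : {set T}) x, S != setT -> x \in S -> 0 <= cover_laplacian F S x) ->
  forall (S : {set T}) x, x \in S -> 0 <= F S x.
Proof.
move=> FT FL; apply: cover_comparison => [x|S x ST xS]; first by rewrite FT.
rewrite /cover_laplacian big1 ?FL// => y _; by rewrite subrr mulr0.
Qed.

End CoverChain.

(** * Expected costs of a random walk before covering *)

Section CoverWalk.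
Local Open Scope classical_set_scope.
Context (R : realType) (d : measure_display) (Om : measurableType d).
Context (P : probability Om R) (T : finType).

Definition prob (A : set Om) : R := fine (P A).

Lemma prob_ge0 A : 0 <= prob A.
Proof. by rewrite fine_ge0. Qed.

Lemma probE A : measurable A -> (prob A)%:E = P A.
Proof. by move=> mA; rewrite fineK// fin_num_measure. Qed.

Lemma measurable_finite_comp (K : finType) (Z : Om -> K) (Q : set K) :
  (forall k, measurable (Z @^-1` [set k])) -> measurable (Z @^-1` Q).
Proof.
move=> mZ; rewrite (_ : _ @^-1` Q = \bigcup_(k in Q) Z @^-1` [set k]).
  by apply: fin_bigcup_measurable => [|k _]; [exact: finite_finset|exact: mZ].
by apply/seteqP; split => om /= => [QZ|[k Qk ->//]]; exists (Z om).
Qed.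

Lemma prob_partition (K : finType) (Z : Om -> K) (A : set Om) :
  (forall k, measurable (Z @^-1` [set k])) -> measurable A ->
  prob A = \sum_k prob (A `&` Z @^-1` [set k]).
Proof.
move=> mZ mA; apply: EFin_inj; rewrite probE// -sumEFin.
rewrite [LHS](_ : _ = P (\bigcup_(k in [set: K]) (A `&` Z @^-1` [set k]))); last first.
  congr (P _); apply/seteqP; split => om /= => [Aom|[k _ []//]].
  by exists (Z om).
have mAZ k : measurable (A `&` Z @^-1` [set k]) by exact: measurableI.
have tAZ : trivIset [set: K] (fun k => A `&` Z @^-1` [set k]).
  by move=> i j _ _ [om [[_ <-] [_ <-]]].
rewrite measure_fin_bigcup//=.
rewrite (fsbigE (enum K)) ?enum_uniq//=; last by move=> k _; rewrite mem_enum.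
rewrite big_enum_cond /=; apply: eq_big => k; last by rewrite probE.
by rewrite in_setT.
Qed.

Context (c : T -> T -> R) (s : T) (X : nat -> Om -> T).
Hypothesis X_walk : random_walk P c s X.

Definition visited (t : nat) (om : Om) : {set T} := [set X i om | i : 'I_t.+1]%SET.

Lemma visitedP t om x :
  reflect (exists2 i, (i <= t)%N & X i om = x) (x \in visited t om).
Proof.
apply: (iffP imsetP) => [[i _ ->]|[i it <-]]; first by exists i; rewrite // -ltnS.
by exists (Ordinal (it : (i < t.+1)%N)).
Qed.

Lemma visitedS t om : visited t.+1 om = (X t.+1 om |: visited t om)%SET.
Proof.
apply/setP => x; rewrite in_setU1.
apply/visitedP/idP => [[i]|/orP[/eqP ->|/visitedP[i it <-]]].
- rewrite leq_eqVlt => /orP[/eqP -> ->|it Xi]; first by rewrite eqxx.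
  by apply/orP; right; apply/visitedP; exists i.
- by exists t.+1.
- by exists i => //; exact: leqW.
Qed.

Lemma current_visited t om : X t om \in visited t om.
Proof. by apply/visitedP; exists t. Qed.

Let mX t x : measurable (X t @^-1` [set x]).
Proof. by case: X_walk. Qed.

(** [random_walk] prescribes the probabilities of whole initial trajectories; the prefix packs such
    a trajectory into a random variable with finitely many values. *)
Definition prefix t om : {ffun 'I_t.+1 -> T} := [ffun i : 'I_t.+1 => X i om].

Lemma measurable_prefix t k : measurable (prefix t @^-1` [set k]).
Proof.
rewrite (_ : _ @^-1` _ = \bigcap_(i in [set: 'I_t.+1]) X i @^-1` [set k i]).
  by apply: fin_bigcap_measurable => [|i _]; [exact: finite_finset|exact: mX].
apply/seteqP; split => om /= => [<- i _ /=|H]; first by rewrite ffunE.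
by apply/ffunP => i; rewrite ffunE; exact: H.
Qed.

Definition state t om : {set T} * T := (visited t om, X t om).

Lemma state_prefix t om :
  state t om = ([set prefix t om i | i : 'I_t.+1]%SET, prefix t om ord_max).
Proof.
by rewrite /state /prefix ffunE; congr (_, _); apply: eq_imset => i; rewrite ffunE.
Qed.

Lemma measurable_state t z : measurable (state t @^-1` [set z]).
Proof.
rewrite (_ : _ @^-1` _ = prefix t @^-1`
  [set k | ([set k i | i : 'I_t.+1]%SET, k ord_max) = z]).
  exact/measurable_finite_comp/measurable_prefix.
by apply/seteqP; split => om /=; rewrite state_prefix.
Qed.

Definition occupation t (z : {set T} * T) : R := prob (state t @^-1` [set z]).

(** The Markov property of the pair of visited set and position. The state at time [t] is a function
    of the prefix, so splitting both sides over prefixes reduces the claim to the trajectory formula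
    of [random_walk]. *)
Lemma occupation_step t z y :
  prob (state t @^-1` [set z] `&` X t.+1 @^-1` [set y]) =
  occupation t z * transition c z.2 y.
Proof.
rewrite /occupation (prob_partition (@measurable_prefix t)); last first.
  by apply: measurableI; [exact: measurable_state|exact: mX].
rewrite (prob_partition (@measurable_prefix t) (measurable_state t z)) mulr_suml.
apply: eq_bigr => k _.
have [kz|kz] := eqVneq ([set k i | i : 'I_t.+1]%SET, k ord_max) z; last first.
  rewrite [X in prob X](_ : _ = set0); last first.
    apply/seteqP; split => om //= -[[zom _] kom]; case/eqP: kz.
    by rewrite -kom -state_prefix.
  rewrite [X in _ = prob X * _](_ : _ = set0); last first.
    apply/seteqP; split => om //= -[zom kom]; case/eqP: kz.
    by rewrite -kom -state_prefix.
  by rewrite /prob measure0 /= mul0r.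
(* The trajectory [k] continued by [y], as a function on all times because [random_walk] quantifies
   over such functions. *)
pose p i := if (i <= t)%N then k (inord i) else y.
have kE om : prefix t om = k <-> forall i, (i <= t)%N -> X i om = p i.
  split=> [kom i it|H]; first by rewrite /p it -kom ffunE inordK.
  apply/ffunP => i; rewrite ffunE H; last by rewrite -ltnS.
  by rewrite /p -ltnS ltn_ord inord_val.
have E1 : [set om | forall i, (i <= t.+1)%N -> X i om = p i] =
    state t @^-1` [set z] `&` X t.+1 @^-1` [set y] `&` prefix t @^-1` [set k].
  apply/seteqP; split => om /= => [H|[[_ Xy] /kE H] i].
    have /kE kom : forall i, (i <= t)%N -> X i om = p i.
      by move=> i it; apply: H; exact: leqW.
    by split=> //; rewrite state_prefix kom kz (H t.+1)// /p ltnn.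
  rewrite leq_eqVlt => /orP[/eqP ->|]; last exact: H.
  by rewrite Xy /p ltnn.
have E2 : [set om | forall i, (i <= t)%N -> X i om = p i] =
    state t @^-1` [set z] `&` prefix t @^-1` [set k].
  apply/seteqP; split => om /= => [/kE kom|[_ /kE//]].
  by rewrite state_prefix kom kz.
have pt : p t = z.2.
  by rewrite /p leqnn -kz /=; congr (k _); apply/val_inj; rewrite /= inordK.
have ptS : p t.+1 = y by rewrite /p ltnn.
have [_ _ /(_ t p)] := X_walk; rewrite E1 E2 pt ptS => /(congr1 fine).
rewrite -/(prob _) => ->; rewrite fineM//.
apply: fin_num_measure; apply: measurableI;
  [exact: measurable_state|exact: measurable_prefix].
Qed.

Lemma occupationS t (S : {set T}) y : occupation t.+1 (S, y) =
  \sum_(z | (y |: z.1)%SET == S) occupation t z * transition c z.2 y.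
Proof.
rewrite {1}/occupation (prob_partition (@measurable_state t) (measurable_state _ _)).
rewrite [RHS]big_mkcond; apply: eq_bigr => z _; rewrite -occupation_step.
have [zS|zS] := eqVneq (y |: z.1)%SET S.
  congr prob; apply/seteqP; split => om /=.
    by case=> -[_ Xy] zE.
  by case=> zE Xy; split=> //; rewrite /state visitedS Xy -zS -zE.
rewrite [X in prob X](_ : _ = set0) ?/prob ?measure0//.
apply/seteqP; split => om //= [[Sv Xy] zE]; case/eqP: zS.
by rewrite -Sv -zE visitedS Xy.
Qed.

Lemma occupation_notin t (S : {set T}) y : y \notin S -> occupation t (S, y) = 0.
Proof.
move=> yS; rewrite /occupation [X in prob X](_ : _ = set0) ?/prob ?measure0//.
apply/seteqP; split => om //= -[Sv Xy]; case/negP: yS.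
by rewrite -Sv -Xy current_visited.
Qed.

(** The walk starts at [s] only almost surely, so the other states are shown to be null rather than
    empty. *)
Lemma occupation0 (F : {set T} * T -> R) :
  \sum_z occupation 0 z * F z = F ([set s]%SET, s).
Proof.
have [_ X0 _] := X_walk.
have v0 om : visited 0 om = [set X 0%N om]%SET.
  apply/setP => x; rewrite finset.in_set1; apply/visitedP/eqP => [[i]|->].
    by rewrite leqn0 => /eqP -> ->.
  by exists 0%N.
rewrite (bigD1 ([set s]%SET, s))//= big1 ?addr0.
  rewrite /occupation (_ : _ @^-1` _ = X 0%N @^-1` [set s]) ?/prob ?X0 ?mul1r//.
  apply/seteqP; split => om /= => [[_ //]|Xs].
  by rewrite /state v0 Xs.
move=> z zs; rewrite [occupation _ _](_ : _ = 0) ?mul0r//.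
apply/eqP; rewrite eq_le prob_ge0 andbT -lee_fin probE; last exact: measurable_state.
have P0 : P (~` (X 0%N @^-1` [set s])) = 0%E.
  by rewrite probability_setC// X0 subee.
apply: (@le_trans _ _ (P (~` (X 0%N @^-1` [set s])))); last by rewrite P0.
apply: le_measure; rewrite ?inE; [exact: measurable_state|exact: measurableC|].
by move=> om /= zE Xs; case/eqP: zs; rewrite -zE /state v0 Xs.
Qed.

Hypothesis c_ge0 : forall x y, 0 <= c x y.
Hypothesis c_conn : forall x y, connect (fun x y => 0 < c x y) x y.
Hypothesis c_pos : forall x, 0 < \sum_y c x y.

Section Visits.
Context (A : pred T) (F : {set T} -> T -> R).
Hypothesis FT : forall x, F [set: T]%SET x = 0.
Hypothesis FL : forall (S : {set T}) x, S != [set: T]%SET -> x \in S ->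
  cover_laplacian c F S x = (\sum_y c x y) * (A x)%:R.

(** This is [FL] divided by the total conductance: one step lowers [F] in the mean by 1 during an
    uncovered visit to [A], and by 0 otherwise. *)
Lemma transition_mean (S : {set T}) x : x \in S ->
  \sum_y transition c x y * F (y |: S)%SET y =
  F S x - ((S != [set: T]%SET) && A x)%:R.
Proof.
move=> xS; have [->|ST] /= := eqVneq S [set: T]%SET.
  by rewrite FT subr0 big1// => y _; rewrite finset.setUT FT mulr0.
have FLx : (\sum_y c x y) * F S x - \sum_y c x y * F (y |: S)%SET y =
    (\sum_y c x y) * (A x)%:R.
  by rewrite -(FL ST xS) mulr_suml -sumrB; apply: eq_bigr => y _; ring.
apply: (mulfI (lt0r_neq0 (c_pos x))); rewrite mulrBr -FLx subKr mulr_sumr.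
apply: eq_bigr => y _; rewrite /transition mulrA mulrCA divff ?mulr1//.
exact: lt0r_neq0.
Qed.

Local Notation a t := (\sum_z occupation t z * F z.1 z.2).

Definition uncovered_visit t : set Om :=
  [set om | (visited t om != [set: T]%SET) && A (X t om)].

Lemma measurable_uncovered_visit t : measurable (uncovered_visit t).
Proof.
exact: (@measurable_finite_comp _ (state t)
  [set z | (z.1 != [set: T]%SET) && A z.2] (measurable_state t)).
Qed.

Lemma prob_uncovered_visit t : prob (uncovered_visit t) =
  \sum_z occupation t z * ((z.1 != [set: T]%SET) && A z.2)%:R.
Proof.
rewrite (prob_partition (@measurable_state t) (@measurable_uncovered_visit t)).
apply: eq_bigr => z _; have [zA|zA] := boolP (_ && _).
  rewrite mulr1; congr prob; apply/seteqP; split => om /= => [[]//|zE].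
  by split=> //; move: zA; rewrite -zE.
rewrite mulr0 [X in prob X](_ : _ = set0) ?/prob ?measure0//.
apply/seteqP; split => om //= -[omA zE]; case/negP: zA.
by rewrite -zE.
Qed.

(** [a t] is the expectation of [F] at time [t]; by [transition_mean] it decreases in one step by
    the probability of an uncovered visit to [A]. *)
Lemma prob_uncovered_visit_telescope t : prob (uncovered_visit t) = a t - a t.+1.
Proof.
rewrite prob_uncovered_visit [X in _ - X](_ : _ = \sum_z occupation t z *
    (F z.1 z.2 - ((z.1 != [set: T]%SET) && A z.2)%:R)).
  rewrite -sumrB; apply: eq_bigr => z _; ring.
(* Regroup the mass at time [t.+1] by the state at time [t] from which it came. *)
rewrite (eq_bigr (fun z => \sum_(z0 : {set T} * T | (z.2 |: z0.1)%SET == z.1)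
    occupation t z0 * transition c z0.2 z.2 * F z.1 z.2)); last first.
  by move=> [S y] _ /=; rewrite occupationS mulr_suml.
rewrite (exchange_big_dep predT)//=; apply: eq_bigr => -[S x] _ /=.
have [xS|xS] := boolP (x \in S); last first.
  by rewrite occupation_notin// mul0r big1// => z _; rewrite !mul0r.
rewrite -transition_mean// mulr_sumr.
rewrite (reindex (fun y => ((y |: S)%SET, y)))/=.
  by apply: eq_big => [y|y _]; rewrite ?eqxx// mulrA.
exists snd => [//|[S' y]]; rewrite inE /= => /eqP -> //.
Qed.

Lemma sum_prob_uncovered_visit n :
  \sum_(0 <= t < n) prob (uncovered_visit t) = F [set s]%SET s - a n.
Proof.
under eq_bigr do rewrite prob_uncovered_visit_telescope.
under eq_bigr do rewrite -opprB.
rewrite sumrN telescope_sumr// opprB; congr (_ - _).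
exact: (occupation0 (fun z => F z.1 z.2)).
Qed.

End Visits.

(** With [A] everything, the partial sums of these probabilities stay below the initial value of a
    nonnegative solution [F]. The series converges, so its terms tend to 0. *)
Lemma prob_uncovered_cvg0 : prob (uncovered_visit predT n) @[n --> \oo] --> 0.
Proof.
have [F [FT FL]] := cover_solution_exists c_ge0 c_conn
  (fun _ x => (\sum_y c x y) * (predT x)%:R).
have F0 (S : {set T}) x : x \in S -> 0 <= F S x.
  apply: cover_solution_ge0 => // {}S {}x ST xS.
  by rewrite FL// mulr1 ltW.
have sumE := sum_prob_uncovered_visit FT FL.
apply: cvg_series_cvg_0; apply: nondecreasing_is_cvgn.
  by apply: nondecreasing_series => n _ _; exact: prob_ge0.
exists (F [set s]%SET s) => _ [n _ <-]; rewrite /series /= sumE gerBl.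
apply: sumr_ge0 => -[S x] _ /=; have [xS|xS] := boolP (x \in S).
  by rewrite mulr_ge0 ?prob_ge0 ?F0.
by rewrite occupation_notin// mul0r.
Qed.

(** [F] vanishes on covered states, so its mean is at most a constant times the probability of not
    having covered. *)
Lemma occupation_cvg0 (F : {set T} -> T -> R) :
  (forall x, F [set: T]%SET x = 0) ->
  (\sum_z occupation n z * F z.1 z.2) @[n --> \oo] --> 0.
Proof.
move=> FT; pose C := \sum_z `|F z.1 z.2|.
have bound n : `|\sum_z occupation n z * F z.1 z.2| <=
    C * prob (uncovered_visit predT n).
  rewrite prob_uncovered_visit mulr_sumr (le_trans (ler_norm_sum _ _ _))//.
  apply: ler_sum => -[S x] _ /=; rewrite normrM ger0_norm ?prob_ge0// andbT.
  have [->|ST] /= := eqVneq S [set: T]%SET; first by rewrite FT normr0 !mulr0.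
  rewrite mulr1 mulrC ler_wpM2r ?prob_ge0//.
  by rewrite /C (bigD1 (S, x))//= lerDl sumr_ge0.
apply/norm_cvg0P; apply: (@squeeze_cvgr _ _ _ _ (cst 0)
  (fun n => C * prob (uncovered_visit predT n))).
- by near=> n; rewrite normr_ge0 bound.
- exact: cvg_cst.
- rewrite -[X in _ --> X](mulr0 C); apply: cvgM; first exact: cvg_cst.
  exact: prob_uncovered_cvg0.
Unshelve. all: by end_near. Qed.

(** Nonnegativity allows the exchange of sum and integral; the sum then telescopes to the initial
    value minus a remainder that tends to 0. *)
Lemma expected_uncovered_visits (A : pred T) (F : {set T} -> T -> R) :
  (forall x, F [set: T]%SET x = 0) ->
  (forall (S : {set T}) x, S != [set: T]%SET -> x \in S ->
     cover_laplacian c F S x = (\sum_y c x y) * (A x)%:R) ->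
  (\int[P]_om \sum_(0 <= t <oo) (\1_(uncovered_visit A t) om)%:E =
   (F [set s]%SET s)%:E)%E.
Proof.
move=> FT FL; rewrite integral_nneseries//; last first.
  move=> t; apply/measurable_EFinP; apply: measurable_indic.
  exact: measurable_uncovered_visit.
rewrite (eq_eseriesr (g := fun t => (prob (uncovered_visit A t))%:E)); last first.
  move=> t _; have mU := @measurable_uncovered_visit A t.
  by rewrite integral_indic// setIT probE.
apply/cvg_lim => //.
rewrite (_ : (fun _ => _) = EFin \o (fun n => F [set s]%SET s -
    \sum_z occupation n z * F z.1 z.2)); last first.
  by apply/funext => n /=; rewrite sumEFin (sum_prob_uncovered_visit FT FL).
apply: cvg_EFin; first by near=> n.
rewrite -[X in _ --> X](subr0 (F [set s]%SET s)); apply: cvgB; first exact: cvg_cst.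
exact: occupation_cvg0.
Unshelve. all: by end_near. Qed.

Lemma lt_cover_time t om :
  ((t%:R)%:E < cover_time R X om)%E = (visited t om != [set: T]%SET).
Proof.
have vT i : (forall x, exists2 j, (j <= i)%N & X j om = x) <->
    visited i om = [set: T]%SET.
  split=> [H|vi x]; last by apply/visitedP; rewrite vi.
  by apply/setP => x; rewrite finset.in_setT; apply/visitedP.
apply/idP/idP => [|vt].
  apply: contraTN => /eqP vt; rewrite -leNgt; apply: ereal_inf_lbound.
  by exists t => //; exact/vT.
apply: (@lt_le_trans _ _ (t.+1%:R)%:E); first by rewrite lte_fin ltr_nat.
apply: le_ereal_inf_tmp => _ [i /vT vi <-]; rewrite lee_fin ler_nat ltnNge.
apply: contra vt => it; rewrite finset.eqEsubset finset.subsetT/= -vi.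
apply/fintype.subsetP => x /visitedP[j ji <-]; apply/visitedP.
by exists j => //; exact: leq_trans it.
Qed.

Lemma visits_before_coverE w om : visits_before_cover R X w om =
  (\sum_(0 <= t <oo) (\1_(uncovered_visit (pred1 w) t) om)%:E)%E.
Proof.
rewrite /visits_before_cover eseries_mkcond; apply: eq_eseriesr => t _.
rewrite indicE lt_cover_time (_ : (om \in uncovered_visit _ _) =
  (visited t om != [set: T]%SET) && (X t om == w)); first by case: ifP.
by apply/idP/idP; rewrite inE.
Qed.

(** The times before covering form an initial segment, so counting them gives the cover time; if
    covering never occurs, both sides are [+oo]. *)
Lemma cover_timeE om : cover_time R X om =
  (\sum_(0 <= t <oo) (\1_(uncovered_visit predT t) om)%:E)%E.
Proof.
have indE t : (\1_(uncovered_visit predT t) om)%:E =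
    ((visited t om != [set: T]%SET)%:R)%:E :> \bar R.
  rewrite indicE; congr ((nat_of_bool _)%:R%:E); apply/idP/idP; rewrite inE /=.
    by case/andP.
  by rewrite /uncovered_visit /= andbT.
rewrite (eq_eseriesr (fun t _ => indE t)).
have vT i : (forall x, exists2 j, (j <= i)%N & X j om = x) ->
    visited i om == [set: T]%SET.
  by move=> H; apply/eqP/setP => x; rewrite finset.in_setT; apply/visitedP.
have [ex|nv] := pselect (exists t, visited t om == [set: T]%SET); last first.
  transitivity (+oo%E : \bar R).
    rewrite /cover_time -[RHS]ereal_inf0; congr ereal_inf.
    by apply/seteqP; split => // y [i /vT vi yE]; apply: nv; exists i.
  apply/esym/eqyP => r r0; have [n rn] : exists n : nat, r <= n%:R.
    by exists (Num.trunc r).+1; exact/ltW/truncnS_gt.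
  apply: (@le_trans _ _ (n%:R)%:E); first by rewrite lee_fin.
  apply: le_trans (nneseries_lim_ge n _); last by move=> *; rewrite lee_fin.
  rewrite sumEFin lee_fin (eq_bigr (fun=> 1)) ?big_const_nat ?subn0 ?iter_addr_0//.
  move=> i _; case: eqP => // /eqP vi; case: nv; by exists i.
case: (ex_minnP ex) => n vn nmin; transitivity (n%:R%:E : \bar R).
  apply/eqP; rewrite eq_le; apply/andP; split.
    apply: ereal_inf_lbound; exists n => // x; apply/visitedP.
    by rewrite (eqP vn) finset.in_setT.
  by apply: le_ereal_inf_tmp => _ [i /vT vi <-]; rewrite lee_fin ler_nat nmin.
rewrite (nneseries_split 0 n); last by move=> *; rewrite lee_fin.
rewrite add0n [X in _ = (_ + X)%E]eseries0 ?adde0; last first.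
  move=> i ni _; rewrite (_ : visited i om = [set: T]%SET) ?eqxx//.
  apply/eqP/vT => x.
  have /visitedP[j jn <-] : x \in visited n om by rewrite (eqP vn) finset.in_setT.
  by exists j => //; exact: leq_trans ni.
rewrite sumEFin; congr (_%:E).
rewrite big_nat_cond (eq_bigr (fun=> 1)) -?big_nat_cond ?big_const_nat ?subn0
  ?iter_addr_0//.
move=> i /andP[/andP[_ i_n] _]; case: eqP => // /eqP vi.
by have := nmin _ vi; rewrite leqNgt i_n.
Qed.

Lemma expected_visits_before_cover w (F : {set T} -> T -> R) :
  (forall x, F [set: T]%SET x = 0) ->
  (forall (S : {set T}) x, S != [set: T]%SET -> x \in S ->
     cover_laplacian c F S x = (\sum_y c x y) * (x == w)%:R) ->
  (\int[P]_om visits_before_cover R X w om = (F [set s]%SET s)%:E)%E.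
Proof.
move=> FT FL; under eq_integral do rewrite visits_before_coverE.
exact: expected_uncovered_visits.
Qed.

Lemma expected_cover_time (F : {set T} -> T -> R) :
  (forall x, F [set: T]%SET x = 0) ->
  (forall (S : {set T}) x, S != [set: T]%SET -> x \in S ->
     cover_laplacian c F S x = \sum_y c x y) ->
  (\int[P]_om cover_time R X om = (F [set s]%SET s)%:E)%E.
Proof.
move=> FT FL; under eq_integral do rewrite cover_timeE.
apply: expected_uncovered_visits => // S x ST xS.
by rewrite FL// mulr1.
Qed.

End CoverWalk.

(** Finiteness of the state space is the source of the constants that are uniform in [lam]. *)
Lemma finite_bound (R : realFieldType) (T : finType) (F : T -> R) :
  exists C : R, 0 <= C /\ forall x, `|F x| <= C.
Proof.
exists (\sum_x `|F x|); split=> [|x]; first exact: sumr_ge0.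
by rewrite (bigD1 x)//= lerDl sumr_ge0.
Qed.

(** * The multigraph obtained by identifying u and v *)

Section Identification.
Import boot.fintype boot.finset.
Context (V : finType) (e : rel V).
Hypothesis e_sym : symmetric e.
Hypothesis e_irr : irreflexive e.
Hypothesis e_conn : forall x y : V, connect e x y.
Context (u v : V).
Hypothesis uv_neq : u != v.
Hypothesis uv_nonadj : ~~ e u v.

Local Notation W := (identified u v).
Local Notation g := (identify u v).
Local Notation w := (merged u v).

Lemma identify_eq_merged x : (g x == w) = (x \in [:: u; v]).
Proof.
rewrite /identify /merged; case: insubP => [z /negbTE -> _ //|].
by rewrite negbK => ->.
Qed.

Lemma identify_u : g u = w.
Proof. by apply/eqP; rewrite identify_eq_merged inE eqxx. Qed.

Lemma identify_v : g v = w.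
Proof. by apply/eqP; rewrite identify_eq_merged !inE eqxx orbT. Qed.

Lemma identify_eq x y : x \notin [:: u; v] -> (g y == g x) = (y == x).
Proof.
move=> xuv; apply/eqP/eqP => [|->//]; rewrite /identify.
case: (insubP _ x) => [zx _ <-|]; last by rewrite xuv.
by case: insubP => // z _ <- [->].
Qed.

Lemma identify_surj (a : W) : exists x, g x = a.
Proof.
case: a => [z|]; last by exists u; exact: identify_u.
by exists (val z); rewrite /identify valK.
Qed.

Lemma neighbour_exists x : exists y, e x y.
Proof.
have [z zx] : exists z, z != x.
  have [->|ux] := eqVneq x u; last by exists u; rewrite eq_sym.
  by exists v; rewrite eq_sym.
have /connectP[[|y p] /=] := e_conn x z; first by move=> _ /eqP; rewrite (negbTE zx).
by case/andP=> xy _ _; exists y.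
Qed.

(** Non-adjacency of [u] and [v] excludes a loop at the merged vertex, irreflexivity excludes all
    others. *)
Lemma edge_identify_neq x y : e x y -> g x != g y.
Proof.
move=> xy; apply/eqP => gxy.
have [xuv|xuv] := boolP (x \in [:: u; v]); last first.
  by move/eqP: gxy; rewrite eq_sym identify_eq// => /eqP yx; rewrite yx e_irr in xy.
have yuv : y \in [:: u; v] by rewrite -identify_eq_merged -gxy identify_eq_merged.
move: xuv yuv xy; rewrite !inE => /orP[] /eqP -> /orP[] /eqP ->; rewrite ?e_irr//.
  by rewrite (negbTE uv_nonadj).
by rewrite e_sym (negbTE uv_nonadj).
Qed.

Section Weights.
Context (R : realFieldType).

(** The share of the vertex [x] of G in the Laplacian on G/uv at [g x]; at the merged vertex it
    separates the edges coming from [u] from those coming from [v]. *)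
Definition out_diff (F : {set W} -> W -> R) (S : {set V}) (x : V) : R :=
  \sum_(y | e x y) (F (g @: S) (g x) - F (g y |: g @: S) (g y)).

Lemma sum_multiplicity (Phi : W -> R) (a : W) :
  \sum_b (multiplicity e a b)%:R * Phi b =
  \sum_(x | g x == a) \sum_(y | e x y) Phi (g y).
Proof.
rewrite pair_big_dep /=.
rewrite (partition_big (fun p : V * V => g p.2) predT)//=; apply: eq_bigr => b _.
rewrite (eq_bigr (fun=> Phi b)); last by move=> p /andP[_ /eqP ->].
rewrite sumr_const -[RHS]mulr_natl; congr (_%:R * _).
rewrite /multiplicity cardsE; apply: eq_card => -[x y].
by rewrite !unfold_in /= -andbA andbCA.
Qed.

Lemma laplacian_multiplicity (F : {set W} -> W -> R) (S : {set V}) (a : W) :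
  cover_laplacian (fun a b => (multiplicity e a b)%:R) F (g @: S) a =
  \sum_(x | g x == a) out_diff F S x.
Proof.
rewrite /cover_laplacian
  (sum_multiplicity (fun b => F (g @: S) a - F (b |: g @: S) b)).
by apply: eq_bigr => x /eqP <-.
Qed.

Lemma sum_fiber (Phi : V -> R) x : x \notin [:: u; v] ->
  \sum_(y | g y == g x) Phi y = Phi x.
Proof. by move=> xuv; apply: big_pred1 => y; rewrite identify_eq. Qed.

Lemma sum_fiber_merged (Phi : V -> R) :
  \sum_(y | g y == w) Phi y = Phi u + Phi v.
Proof.
rewrite (bigD1 u)/=; last by rewrite identify_eq_merged inE eqxx.
congr (_ + _); apply: big_pred1 => y; rewrite identify_eq_merged !inE.
have [->|yu] /= := eqVneq y u; first by rewrite (negbTE uv_neq).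
by rewrite andbT.
Qed.

Lemma multiplicity_gt0 x y : e x y -> (0 < multiplicity e (g x) (g y))%N.
Proof. by move=> xy; apply/card_gt0P; exists (x, y); rewrite inE /= xy !eqxx. Qed.

Lemma multiplicity_conn (a b : W) :
  connect (fun a b => 0 < (multiplicity e a b)%:R :> R) a b.
Proof.
have [x <-] := identify_surj a; have [y <-] := identify_surj b.
have /connectP[p pp ->] := e_conn x y.
elim: p x pp => [|z p IH] x /=; first by rewrite connect0.
case/andP => xz /IH; apply: connect_trans; apply: connect1.
by rewrite ltr0n multiplicity_gt0.
Qed.

Lemma sum_multiplicity_gt0 (a : W) : 0 < \sum_b (multiplicity e a b)%:R :> R.
Proof.
have [x <-] := identify_surj a; have [y xy] := neighbour_exists x.
rewrite (bigD1 (g y))//= ltr_pwDl ?sumr_ge0//.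
by rewrite ltr0n multiplicity_gt0.
Qed.

Lemma sum_multiplicity_merged :
  \sum_b (multiplicity e w b)%:R = (degree e u + degree e v)%:R :> R.
Proof.
have := sum_multiplicity (fun=> 1) w; under eq_bigr do rewrite mulr1.
by move=> ->; rewrite sum_fiber_merged !sumr_const natrD /degree !cardsE.
Qed.

End Weights.
End Identification.

(** * The network with the additional edge uv *)

Section Conductance.
Import boot.fintype boot.finset.
Context (R : realType) (V : finType) (e : rel V).
Hypothesis e_conn : forall x y : V, connect e x y.
Context (u v : V).
Hypothesis uv_neq : u != v.

Lemma eq_set2_uv x y : ([set x; y] == [set u; v]) =
  ((x == u) && (y == v)) || ((x == v) && (y == u)).
Proof.
apply/eqP/idP => [/setP E|/orP[] /andP[/eqP -> /eqP ->]//]; last first.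
  by rewrite setUC.
have := E x; have := E y; have := E u; have := E v; rewrite !inE !eqxx orbT /=.
rewrite (eq_sym u x) (eq_sym u y) (eq_sym v x) (eq_sym v y).
have [->|xu] /= := eqVneq x u; first by rewrite (negbTE uv_neq) /= => ->.
have [->|xv] /= := eqVneq x v; first by move=> _ ->.
by move=> _ _ _.
Qed.

Context (lam : R).
Hypothesis lam_ge0 : 0 <= lam.
Local Notation c := (conductance e u v lam).

Lemma sum_conductance (Phi : V -> R) x : \sum_y c x y * Phi y =
  \sum_(y | e x y) Phi y + lam * ((x == u)%:R * Phi v + (x == v)%:R * Phi u).
Proof.
rewrite (eq_bigr (fun y => (e x y)%:R * Phi y +
    lam * (((x == u) && (y == v) || ((x == v) && (y == u)))%:R * Phi y))); last first.
  by move=> y _; rewrite /conductance eq_set2_uv mulrDl mulrA.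
rewrite big_split /= -mulr_sumr; congr (_ + lam * _).
  rewrite [RHS]big_mkcond; apply: eq_bigr => y _.
  by case: (e x y); rewrite ?mul1r ?mul0r.
rewrite (bigD1 v)//= (bigD1 u)//= big1 ?addr0.
  rewrite !eqxx (negbTE uv_neq) (eq_sym v) (negbTE uv_neq) !andbT !andbF orbF /=.
  by [].
by move=> y /andP[/negbTE -> /negbTE ->]; rewrite !andbF mul0r.
Qed.

Lemma conductance_ge0 x y : 0 <= c x y.
Proof. by rewrite addr_ge0// mulr_ge0. Qed.

Lemma conductance_conn x y : connect (fun x y => 0 < c x y) x y.
Proof.
apply: connect_sub (e_conn x y) => z t zt; apply: connect1.
by rewrite /conductance zt ltr_pwDl// mulr_ge0.
Qed.

Lemma sum_conductance_gt0 x : 0 < \sum_y c x y.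
Proof.
have [y xy] := neighbour_exists e_conn uv_neq x.
rewrite (bigD1 y)//= ltr_pwDl ?sumr_ge0//; last by move=> *; exact: conductance_ge0.
by rewrite /conductance xy ltr_pwDl// mulr_ge0.
Qed.

End Conductance.

(** * Asymptotics for large conductance of the edge uv *)

Section LargeConductance.
Import boot.fintype boot.finset.
Context (R : realType) (V : finType) (e : rel V).
Hypothesis e_conn : forall x y : V, connect e x y.
Context (u v : V).
Hypothesis uv_neq : u != v.

Local Notation W := (identified u v).
Local Notation g := (identify u v).
Local Notation w := (merged u v).
Local Notation m := (fun a b : W => (multiplicity e a b)%:R : R).
Local Notation c lam := (conductance e u v lam).

Lemma laplacian_conductance (lam : R) (G : {set V} -> V -> R) S x :
  cover_laplacian (c lam) G S x = \sum_(y | e x y) (G S x - G (y |: S) y) +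
   lam * ((x == u)%:R * (G S u - G (v |: S) v) +
          (x == v)%:R * (G S v - G (u |: S) u)).
Proof.
rewrite /cover_laplacian
  (sum_conductance _ uv_neq _ (fun y => G S x - G (y |: S) y)).
congr (_ + lam * (_ + _)).
  by have [->|] := eqVneq x u; rewrite ?mul0r.
by have [->|] := eqVneq x v; rewrite ?mul0r.
Qed.

(* Chosen so that lam times the drop of tilt along uv evens out the outflows
   lam * out_diff F S u and lam * out_diff F S v, whose sum is 2 * lam. *)
Definition tilt (F : {set W} -> W -> R) (S : {set V}) (x : V) : R :=
  (x == u)%:R * ((g @: S != setT)%:R * (1 - out_diff e F S u)).

Definition lifted (lam : R) (F : {set W} -> W -> R) (S : {set V}) (x : V) : R :=
  lam * F (g @: S) (g x) + tilt F S x.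

Definition tilt_diff (F : {set W} -> W -> R) (S : {set V}) (x : V) : R :=
  \sum_(y | e x y) (tilt F S x - tilt F (y |: S) y).

(** At [u] the heavy edge carries [lam * (1 - out_diff e F S u)], which completes
    [lam * out_diff e F S u] to [lam]. At [v] the same current arrives with the opposite sign, and
    [lam] remains because the two values of [out_diff] add up to 2. The tilt has no factor [lam], so
    along ordinary edges it only contributes [tilt_diff]. *)
Lemma laplacian_lifted (lam : R) (F : {set W} -> W -> R) (S : {set V}) x :
  (w \in g @: S -> cover_laplacian m F (g @: S) w = 2) ->
  g @: S != setT -> x \in S ->
  cover_laplacian (c lam) (lifted lam F) S x =
    lam * (if x \in [:: u; v] then 1 else out_diff e F S x) + tilt_diff F S x.
Proof.
move=> F2 ST xS; rewrite laplacian_conductance.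
have -> : \sum_(y | e x y) (lifted lam F S x - lifted lam F (y |: S) y) =
    lam * out_diff e F S x + tilt_diff F S x.
  rewrite mulr_sumr -big_split /=; apply: eq_bigr => y _.
  by rewrite /lifted imsetU1; ring.
have vu : (v == u) = false by rewrite eq_sym; exact: negbTE.
rewrite !inE; have [xu|xu] /= := eqVneq x u.
  have wS : w \in g @: S by rewrite -(identify_u u v) -xu imset_f.
  rewrite xu (negbTE uv_neq) /lifted {2}/tilt vu /tilt eqxx ST.
  by rewrite imsetU1 identify_v identify_u (setUidPr _) ?sub1set// /=; ring.
have [xv|xv] /= := eqVneq x v; last by ring.
have wS : w \in g @: S by rewrite -(identify_v u v) -xv imset_f.
(* As [v] is in [S], the merged vertex is already in the image; the tilt at [u] is therefore the
   same for [u |: S] as for [S]. *)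
have E : g @: (u |: S) = g @: S.
  by rewrite imsetU1 identify_u (setUidPr _) ?sub1set.
have := F2 wS; rewrite laplacian_multiplicity sum_fiber_merged// => /eqP.
rewrite addrC eq_sym -subr_eq => /eqP Fv.
rewrite xv /lifted {2}/tilt E /tilt vu eqxx E ST identify_v identify_u -Fv.
rewrite [out_diff e F (u |: S) u](_ : _ = out_diff e F S u) ?/out_diff ?E//.
by rewrite /=; ring.
Qed.

Lemma sum_conductance1 (lam : R) x : \sum_y c lam x y =
  (degree e x)%:R + lam * (x \in [:: u; v])%:R.
Proof.
have := sum_conductance e uv_neq lam (fun=> 1) x; under eq_bigr do rewrite mulr1.
move=> ->; rewrite !mulr1 sumr_const; congr (_%:R + lam * _).
  by rewrite /degree cardsE.
rewrite !inE; have [->|_] := eqVneq x u; last by rewrite add0r.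
by rewrite (negbTE uv_neq) addr0.
Qed.

Lemma degree_le x : (degree e x)%:R <= #|V|%:R :> R.
Proof. by rewrite ler_nat max_card. Qed.

(** * A barrier for the time spent after G/uv is covered *)

Section Barrier.
Context (T1 : {set W} -> W -> R).
Hypothesis T1T : forall a, T1 setT a = 0.
Hypothesis T1L : forall (S : {set W}) a, S != setT -> a \in S ->
  cover_laplacian m T1 S a = 2.

Lemma barrier_ge0 (S : {set W}) a : a \in S -> 0 <= T1 S a.
Proof.
apply: (@cover_solution_ge0 _ _ m) => //.
  by move=> a' b; exact: multiplicity_conn.
by move=> {}S {}a ST aS; rewrite T1L.
Qed.

(* T1 with only w left to visit, hence a Lyapunov function for hitting w. *)
Definition hit (a : W) : R := if a == w then 0 else T1 (~: [set w]) a.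

Lemma hit_ge0 a : 0 <= hit a.
Proof. by rewrite /hit; case: eqP => // /eqP aw; apply: barrier_ge0; rewrite !inE. Qed.

(** When only the merged vertex is missing, a step to it completes the cover and any other step
    leaves the visited set unchanged; the equation for [T1] thus becomes one for [hit]. *)
Lemma hit_diff x : x \notin [:: u; v] ->
  \sum_(y | e x y) (hit (g x) - hit (g y)) = 2.
Proof.
move=> xuv; have xw : g x != w by rewrite identify_eq_merged.
have wT : ~: [set w] != setT.
  by apply/eqP => /setP /(_ w); rewrite !inE eqxx.
rewrite -(@T1L (~: [set w]) (g x)) ?inE// /cover_laplacian.
rewrite (sum_multiplicity e (fun b => T1 (~: [set w]) (g x) - T1 (b |: ~: [set w]) b)).
rewrite sum_fiber//; apply: eq_bigr => y _.
rewrite /hit (negbTE xw); congr (_ - _); case: eqP => [->|/eqP yw].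
  by rewrite setUCr T1T.
by rewrite (setUidPr _)// sub1set !inE.
Qed.

Lemma image_full (S : {set V}) : g @: S = setT ->
  forall x, x \notin [:: u; v] -> x \in S.
Proof.
move=> ST x xuv; have : g x \in g @: S by rewrite ST inE.
by case/imsetP => y yS /esym/eqP; rewrite identify_eq// => /eqP <-.
Qed.

(* Once G/uv is covered, only u or v can be missing in G, and it is reached in
   time O(1) because the walk crosses the heavy edge as soon as it hits w. *)
Lemma cover_after_image_full : exists M : R, 0 <= M /\
  forall (lam : R) (h : {set V} -> V -> R), 1 <= lam ->
  (forall x, h setT x = 0) ->
  (forall (S : {set V}) x, S != setT -> x \in S ->
     cover_laplacian (c lam) h S x = \sum_y c lam x y) ->
  forall (S : {set V}) x, g @: S = setT -> x \in S -> h S x <= M.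
Proof.
have [Ct [Ct0 hitC]] := finite_bound hit.
pose n : R := #|V|%:R; have n0 : 0 <= n by exact: ler0n.
(* Multiplied by [lam >= 1], the three terms pay for the conductance of the edge uv, for the degree,
   and for the possible loss of [n * hit] along the other edges. *)
pose b := 1 + n + n * (n * Ct).
have nC0 : 0 <= n * (n * Ct) by rewrite !mulr_ge0.
have b0 : 0 <= b by rewrite /b !addr_ge0.
exists (b + n * Ct); split; first by rewrite addr_ge0// mulr_ge0.
move=> lam h lam1 hT hL.
have lam0 : 0 <= lam by exact: le_trans lam1.
(* Away from [u] and [v] the term [n * hit] has Laplacian [2 * n], which is at least the degree; at
   [u] and [v] the drop of [b] along the heavy edge does the work. *)
pose B (S : {set V}) x := b * (S != setT)%:R + n * hit (g x).
have Bdiff (S : {set V}) x y : S != setT ->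
    n * (hit (g x) - hit (g y)) <= B S x - B (y |: S) y.
  move=> ST; rewrite /B ST mulrBr opprD addrACA lerDr subr_ge0 ler_wpM2l//.
  by case: (_ != _).
have hit_out x : n * - (n * Ct) <= \sum_(y | e x y) n * (0 - hit (g y)).
  rewrite -mulr_sumr ler_wpM2l//; under eq_bigr do rewrite sub0r.
  rewrite sumrN lerN2.
  apply: le_trans (_ : \sum_(y | e x y) Ct <= _).
    by apply: ler_sum => y _; exact: le_trans (ler_norm _) (hitC _).
  by rewrite sumr_const -mulr_natl ler_wpM2r// ler_nat max_card.
(* Used when the walk stands at one end [x] of the heavy edge and only the other end [x'] is
   missing, so that crossing lowers [B] by [b]. *)
have end_case x x' (S : {set V}) : g x = w -> S != setT -> x' |: S = setT ->
    (degree e x)%:R + lam <= \sum_(y | e x y) (B S x - B (y |: S) y) +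
      lam * (B S x - B (x' |: S) x') \/ g x' != w.
  move=> gx ST x'S; have [gx'|] := eqVneq (g x') w; [left|by right].
  rewrite {3 4}/B ST x'S eqxx gx gx' /hit eqxx mulr0 !addr0 mulr1 mulr0 subr0.
  have : n * - (n * Ct) <= \sum_(y | e x y) (B S x - B (y |: S) y).
    apply: le_trans (hit_out x) _; apply: ler_sum => y _.
    apply: le_trans (Bdiff S x y ST); rewrite gx /hit eqxx.
    by [].
  have := degree_le x; rewrite -/n /b; move: (\sum_(y | _) _) => Z dn Zn.
  have : 0 <= (lam - 1) * (n + n * (n * Ct)) by rewrite mulr_ge0 ?subr_ge0 ?addr_ge0.
  nra.
have BL (S : {set V}) x : g @: S = setT -> S != setT -> x \in S ->
    \sum_y c lam x y <= cover_laplacian (c lam) B S x.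
  move=> gS ST xS; rewrite sum_conductance1 laplacian_conductance.
  have Sfull := image_full gS.
  have out y : y \in [:: u; v] -> y \in S -> forall y', y' \in [:: u; v] ->
      y' != y -> y' |: S = setT.
    move=> yuv yS y' y'uv y'y; apply/setP => z; rewrite !inE.
    have [//|zy'] := eqVneq z y'; have [zuv|/Sfull//] := boolP (z \in [:: u; v]).
    suff -> : z = y by rewrite yS.
    move: yuv y'uv zuv zy' y'y; rewrite !inE.
    by do 3 case/orP => /eqP ->; rewrite ?eqxx// => *; rewrite ?eqxx.
  have uuv : u \in [:: u; v] by rewrite inE eqxx.
  have vuv : v \in [:: u; v] by rewrite !inE eqxx orbT.
  have vu : v != u by rewrite eq_sym.
  have [xuv|xuv] := boolP (x \in [:: u; v]); last first.
    move: (xuv); rewrite !inE => /norP[/negbTE -> /negbTE ->].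
    rewrite !mul0r addr0 !mulr0 !addr0.
    apply: le_trans (_ : \sum_(y | e x y) n * (hit (g x) - hit (g y)) <= _).
      by rewrite -mulr_sumr hit_diff//; have := degree_le x; rewrite -/n; lra.
    by apply: ler_sum => y _; exact: Bdiff.
  rewrite mulr1; move: (xuv); rewrite !inE => /orP[] /eqP xE; move: xS; rewrite xE => xS.
    rewrite eqxx (negbTE uv_neq) mul1r mul0r addr0.
    case: (end_case u v S (identify_u u v) ST (out _ uuv xS _ vuv vu)) => //.
    by rewrite identify_v eqxx.
  rewrite eqxx (negbTE vu) mul1r mul0r add0r.
  case: (end_case v u S (identify_v u v) ST (out _ vuv xS _ uuv uv_neq)) => //.
  by rewrite identify_u eqxx.
move=> S x gS xS; apply: (@le_trans _ _ (B S x)); last first.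
  rewrite /B lerD//; first by case: (_ != _); rewrite ?mulr1 ?mulr0.
  by rewrite ler_wpM2l//; exact: le_trans (ler_norm _) (hitC _).
rewrite -subr_le0.
(* Sets with full image keep a full image when vertices are added, so the maximum principle may be
   restricted to them. *)
apply: (@cover_max_principle _ _ (c lam) _ _ [pred S : {set V} | g @: S == setT]
    (fun S x => h S x - B S x)) => //=.
- by move=> y z; exact: conductance_ge0.
- by move=> y z; exact: conductance_conn.
- by move=> {gS}S {xS}x y /eqP gS _ _; rewrite imsetU1 gS setUT.
- move=> {gS}S {xS}x /eqP gS xS; have [->|ST] := eqVneq S setT.
    by left; rewrite hT sub0r oppr_le0 /B eqxx mulr0 add0r mulr_ge0// hit_ge0.
  right; split=> //; rewrite (cover_laplacianD _ h (fun S x => - B S x)).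
  rewrite -[X in _ + X](_ : -1 * cover_laplacian (c lam) B S x = _); last first.
    rewrite -cover_laplacianZ; apply: eq_bigr => y _; by rewrite !mulN1r.
  by rewrite hL// mulN1r subr_le0 BL.
- by rewrite gS.
Qed.

End Barrier.

(** [h] and the lift of [K] have the same Laplacian up to an error bounded in [lam], and a bounded
    barrier absorbs this error. [C] and [L] are chosen before [lam] and [h], as the limit
    requires. *)
Lemma cover_asymptotics (K : {set W} -> W -> R) :
  (forall a, K setT a = 0) ->
  (forall (S : {set W}) a, S != setT -> a \in S ->
     cover_laplacian m K S a = 2 * (a == w)%:R) ->
  exists C L : R, forall (lam : R) (h : {set V} -> V -> R), L <= lam ->
  (forall x, h setT x = 0) ->
  (forall (S : {set V}) x, S != setT -> x \in S ->
     cover_laplacian (c lam) h S x = \sum_y c lam x y) ->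
  forall (S : {set V}) x, x \in S -> `|h S x - lam * K (g @: S) (g x)| <= C.
Proof.
move=> KT KL.
have [T1 [T1T T1L]] := cover_solution_exists (c := m) (fun _ _ => ler0n _ _)
  (fun a b => multiplicity_conn e_conn R a b) (fun _ _ => 2).
have [M [M0 hM]] := cover_after_image_full T1T T1L.
pose state := ({set V} * V)%type.
have [C0 [C00 C0P]] := finite_bound (R := R)
  (fun z : state => (degree e z.2)%:R - tilt_diff K z.1 z.2).
have [CT [CT0 CTP]] := finite_bound (R := R) (fun z : state => tilt_diff T1 z.1 z.2).
have [C1 [C10 C1P]] := finite_bound (R := R) (fun z : state => T1 (g @: z.1) (g z.2)).
have [C2 [C20 C2P]] := finite_bound (R := R) (fun z : state => tilt T1 z.1 z.2).
have [C3 [C30 C3P]] := finite_bound (R := R) (fun z : state => tilt K z.1 z.2).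
(* [C3] pays for the tilt of [K]; the remaining terms are an upper bound for the barrier [B]
   introduced next. The threshold makes [CT] at most [lam / 2]. *)
exists (C3 + (M + 2 * C0 * (C1 + C2))), (1 + 2 * CT) => lam h lamL hT hL.
have lam1 : 1 <= lam by lra.
have lam_gt0 : 0 < lam by lra.
have lam0 : 0 <= lam by lra.
have h0 (S : {set V}) x : x \in S -> 0 <= h S x.
  apply: (@cover_solution_ge0 _ _ (c lam)) => //.
  - by move=> y z; exact: conductance_ge0.
  - by move=> y z; exact: conductance_conn.
  by move=> {}S {}x ST xS; rewrite hL// ltW// sum_conductance_gt0.
(* Before G/uv is covered, [lifted lam T1] has Laplacian at least [lam - CT], hence at least
   [lam / 2]; the factor [2 * C0 / lam] turns this into [C0] and keeps [B] bounded. *)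
pose B (S : {set V}) x := M + 2 * C0 / lam * lifted lam T1 S x.
have lift0 (F : {set W} -> W -> R) (S : {set V}) x :
    (forall a, F setT a = 0) -> g @: S = setT ->
    lifted lam F S x = 0.
  by move=> FT gS; rewrite /lifted /tilt gS FT eqxx mul0r !mulr0 addr0.
have BL (S : {set V}) x : g @: S != setT -> x \in S ->
    C0 <= cover_laplacian (c lam) B S x.
  move=> ST xS; rewrite (cover_laplacianD _ (fun _ _ => M)) cover_laplacian_cst add0r.
  rewrite cover_laplacianZ laplacian_lifted//; last by move=> wS; rewrite T1L.
  have : 1 <= (if x \in [:: u; v] then 1 else out_diff e T1 S x).
    case: ifPn => // xuv; rewrite -[out_diff _ _ _ _](@sum_fiber _ u v R)//.
    by rewrite -laplacian_multiplicity T1L ?imset_f// ler1n.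
  move: (if _ then _ else _) => th th1.
  have := CTP (S, x); rewrite ler_norml => /andP[/= sT _].
  rewrite mulrDr -mulrA mulKf ?gt_eqF// -[leLHS]mulr1.
  have -> : 2 * C0 * th + 2 * C0 / lam * tilt_diff T1 S x =
    C0 * (2 * (th + tilt_diff T1 S x / lam)) by ring.
  rewrite ler_wpM2l//.
  have : - (1 / 2) <= tilt_diff T1 S x / lam; last by lra.
  by rewrite ler_pdivlMr//; lra.
(* The terms of order [lam] cancel: at [u] and [v] both Laplacians contain exactly [lam], and
   elsewhere [K] is harmonic. *)
have DL (S : {set V}) x : g @: S != setT -> x \in S ->
    cover_laplacian (c lam) (fun S x => h S x + -1 * lifted lam K S x) S x =
    (degree e x)%:R - tilt_diff K S x.
  move=> ST xS; rewrite cover_laplacianD cover_laplacianZ laplacian_lifted//; last first.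
    by move=> wS; rewrite KL// eqxx mulr1.
  have SnT : S != setT.
    apply: contra ST => /eqP ->; apply/eqP/setP => a; rewrite inE.
    by have [y <-] := identify_surj a; rewrite imset_f.
  rewrite hL// sum_conductance1//; case: ifPn => xuv; first by rewrite mulr1; ring.
  rewrite -[out_diff _ _ _ _](@sum_fiber _ u v R)// -laplacian_multiplicity.
  rewrite KL ?imset_f// (_ : (g x == w) = false) ?mulr0; first by ring.
  by rewrite identify_eq_merged; exact: negbTE.
(* The two signs of [k] give the upper and the lower bound. *)
have main (k : R) : k = 1 \/ k = -1 -> forall (S : {set V}) x, x \in S ->
    k * (h S x + -1 * lifted lam K S x) <= B S x.
  move=> k1 S x xS; rewrite -subr_le0 -[X in _ + X <= _]mulN1r.
  apply: (@cover_max_principle _ _ (c lam) _ _ predT (fun S x =>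
     k * (h S x + -1 * lifted lam K S x) + -1 * B S x)) => //.
  - by move=> y z; exact: conductance_ge0.
  - by move=> y z; exact: conductance_conn.
  move=> {xS}S {}x _ xS; have [ST|ST] := eqVneq (g @: S) setT.
    left; rewrite /B !lift0// mulr0 !addr0 mulr0 addr0 mulN1r subr_le0.
    have := hM _ _ lam1 hT hL _ _ ST xS; have := h0 _ _ xS.
    by case: k1 => ->; lra.
  right; split.
    apply: contra ST => /eqP ->; apply/eqP/setP => a; rewrite inE.
    by have [y <-] := identify_surj a; rewrite imset_f.
  rewrite cover_laplacianD !cover_laplacianZ DL//.
  have := C0P (S, x); rewrite ler_norml /= => /andP[].
  by have := BL S x ST xS; case: k1 => ->; lra.
move=> S x xS.
have := main 1 (or_introl erefl) S x xS; have := main (-1) (or_intror erefl) S x xS.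
have := C3P (S, x); rewrite ler_norml => /= /andP[k1 k2].
rewrite /lifted => m1 m2.
have BC : B S x <= M + 2 * C0 * (C1 + C2).
  rewrite /B lerD2l /lifted -!mulrA ler_wpM2l// ler_wpM2l// mulrDr mulKf ?gt_eqF//.
  have := C1P (S, x); rewrite ler_norml => /= /andP[_ t1].
  have := C2P (S, x); rewrite ler_norml => /= /andP[_ t2].
  apply: lerD => //; rewrite mulrC ler_pdivrMr//.
  by apply: le_trans t2 _; rewrite ler_peMr.
move: BC m1 m2; move: (B S x) => b.
by rewrite ler_norml => *; apply/andP; split; lra.
Qed.

End LargeConductance.

(** * Graphs in which every path between two vertices covers everything *)

Section PathCriterion.
Import boot.fintype boot.finset.
Context (T : finType) (E : rel T).
Hypothesis E_sym : symmetric E.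
Hypothesis E_irr : irreflexive E.

(** A duplicate-free path from [a] to [b] enumerates all vertices. A chord between two
    non-consecutive vertices of it would give a shortcut missing the vertices in between, against
    the hypothesis. *)
Lemma path_graph_of_covering_paths (a b : T) : connect E a b ->
  (forall p, path E a p -> last a p = b -> forall y, y \in a :: p) ->
  path_graph_between E a b.
Proof.
case/connectP => p0 p0E; case: (shortenP p0E) => p pE pU _ bE pcov'.
have pcov := pcov' p pE (esym bE).
pose x (i : 'I_(size p).+1) := nth a (a :: p) i.
exists (size p), x; split.
- have xinj : injective x.
    by move=> i j /eqP; rewrite nth_uniq//= => /eqP ij; exact: val_inj.
  apply: inj_card_bij xinj _; rewrite card_ord.
  have <- : #|a :: p| = (size p).+1 by exact/card_uniqP.
  by apply: subset_leq_card; apply/subsetP => y _; exact: pcov.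
- by [].
- by rewrite /x /= nth_last bE.
move=> i j; wlog ij : i j / (i <= j)%N.
  move=> W; have [/W //|/ltnW ji] := leqP i j.
  by rewrite E_sym W// orbC.
have [ij1|ij1] := eqVneq (j : nat) i.+1.
  rewrite orTb /x ij1 /=; move/(pathP a): pE; apply.
  by rewrite -ltnS -ij1.
rewrite /= [in RHS](_ : (i == j.+1 :> nat) = false); last first.
  by apply/negbTE; rewrite neq_ltn ltnS ij.
have [ij0|ij0] := eqVneq i j; first by rewrite ij0 E_irr.
have lt_ij : (i.+1 < j)%N.
  by rewrite ltn_neqAle eq_sym ij1 ltn_neqAle ij andbT ij0.
apply/negbTE/negP => xij.
have jp : (j <= size p)%N by rewrite -ltnS.
(* The shortcut along the chord. Positions count from [a], so [x j] is entry [j.-1] of [p], and the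
   skipped vertex after [x i] is [nth a p i]. *)
pose q := take i p ++ drop j.-1 p.
have j1 : j.-1.+1 = j by rewrite prednK//; exact: leq_ltn_trans lt_ij.
have dropE : drop j.-1 p = x j :: drop j p.
  by rewrite (drop_nth a) ?j1// /x -j1.
have lastE k : (k <= size p)%N -> last a (take k p) = nth a (a :: p) k.
  move=> kp; rewrite (last_nth a) size_takel//.
  by case: k kp => //= k kp; rewrite nth_take.
have ip : (i <= size p)%N by exact: leq_trans jp.
have := pE; rewrite -{1}(cat_take_drop j p) cat_path lastE// => /andP[_ pjE].
have qE : path E a q.
  rewrite cat_path take_path//= lastE// dropE /= pjE andbT.
  exact: xij.
have qb : last a q = b.
  by rewrite last_cat dropE /= bE -[in RHS](cat_take_drop j p) last_cat lastE.
have ipS : (i < size p)%N by apply: leq_trans jp; exact: ltnW.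
have /andP[ap up] := pU.
(* The skipped vertex would have to be [a], or lie before or after the chord; each case contradicts
   uniqueness. *)
have := pcov' q qE qb (nth a p i); rewrite inE mem_cat => /or3P[/eqP ia|it|id].
- by case/negP: ap; rewrite -ia mem_nth.
- by move: it; rewrite in_take ?mem_nth// index_uniq// ltnn.
have : uniq (take j.-1 p ++ drop j.-1 p) by rewrite cat_take_drop.
rewrite cat_uniq => /and3P[_ /hasPn/(_ _ id)/negP[]].
by rewrite /= in_take ?mem_nth// index_uniq// -ltnS j1.
Qed.

End PathCriterion.

(** * Vanishing of the expected number of visits *)

Section VisitsVanish.
Import boot.fintype boot.finset.
Context (R : realFieldType) (T : finType) (c : T -> T -> R) (E : rel T) (w : T).
Hypothesis c_ge0 : forall x y, 0 <= c x y.
Hypothesis c_conn : forall x y, connect (fun x y => 0 < c x y) x y.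
Hypothesis c_pos : forall x, 0 < \sum_y c x y.
Hypothesis cE : forall x y, (0 < c x y) = E x y.
Hypothesis E_sym : symmetric E.
Hypothesis E_irr : irreflexive E.
Context (F : {set T} -> T -> R).
Hypothesis FT : forall x, F setT x = 0.
Hypothesis FL : forall (S : {set T}) x, S != setT -> x \in S ->
  cover_laplacian c F S x = (\sum_y c x y) * (x == w)%:R.

Lemma visits_ge0 (S : {set T}) x : x \in S -> 0 <= F S x.
Proof.
by apply: (cover_solution_ge0 c_ge0) => // {}S {}x ST xS; rewrite FL// mulr_ge0// ltW.
Qed.

(** A zero is a minimum of the nonnegative [F], so the Laplacian there is minus a sum of nonnegative
    terms. As the source is nonnegative too, both vanish, term by term. *)
Lemma visits_step (S : {set T}) x : S != setT -> x \in S -> F S x = 0 ->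
  x != w /\ forall y, E x y -> F (y |: S) y = 0.
Proof.
move=> ST xS F0; have := FL ST xS.
rewrite /cover_laplacian F0; under eq_bigr do rewrite sub0r mulrN.
rewrite sumrN => L.
have t0 y : 0 <= c x y * F (y |: S) y by rewrite mulr_ge0// visits_ge0// setU11.
have s0 : 0 <= \sum_y c x y * F (y |: S) y by apply: sumr_ge0.
have xw : x != w.
  apply/eqP => xw; move: L s0; rewrite xw eqxx mulr1 => L; have := c_pos w.
  by rewrite -L oppr_gt0 => /lt_geF ->.
split=> // y; rewrite -cE => cxy.
move: L; rewrite (negbTE xw) mulr0 => /eqP; rewrite oppr_eq0 => /eqP L.
have /(_ y isT)/eqP := psumr_eq0P (fun y _ => t0 y) L.
by rewrite mulf_eq0 gt_eqF//= => /eqP.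
Qed.

Lemma visits_start_gt0 : [set w] != setT -> 0 < F [set w] w.
Proof.
move=> wT; have wS := set11 w; rewrite lt_def visits_ge0// andbT.
by apply/eqP => /(visits_step wT wS) []; rewrite eqxx.
Qed.

(** The zero propagates along the path until everything is visited; this happens at the latest on
    reaching [w], where an uncovered state cannot have value 0. *)
Lemma visits_eq0_covering (S : {set T}) x p : x \in S -> F S x = 0 ->
  path E x p -> last x p = w -> forall y, (y \in S) || (y \in p).
Proof.
elim: p S x => [|z p IH] S x xS F0 /=.
  have [->|ST] := eqVneq S setT; first by move=> _ _ y; rewrite inE.
  by move=> _ xw; have [/eqP] := visits_step ST xS F0.
case/andP => xz pE lw y; have [->|ST] := eqVneq S setT; first by rewrite inE.
have [_ /(_ z xz) Fz] := visits_step ST xS F0.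
have := IH _ z (setU11 _ _) Fz pE lw y.
by rewrite !inE -orbA orbCA.
Qed.

(** If the value vanishes, every path to [w] covers, which forces a path graph. Conversely, a walk
    on a path started at one end has covered everything when it first reaches the other end. *)
Lemma visits_eq0P (a : T) : a != w ->
  F [set a] a = 0 <-> path_graph_between E a w.
Proof.
move=> aw; split=> [F0|].
  have aw_conn : connect E a w.
    by have := c_conn a w; rewrite (@eq_connect _ _ E).
  apply: path_graph_of_covering_paths => // p pE pw y.
  have := visits_eq0_covering (set11 a) F0 pE pw y.
  by rewrite !inE.
case=> n [x [[xi xiK ixK] x0 xn xE]].
(* The visited sets are initial segments of the path, so w is reached last. *)
pose D := [pred S : {set T} | [forall i : 'I_n.+1, forall j : 'I_n.+1,
  (i < j)%N ==> (x j \in S) ==> (x i \in S)]].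
have DP (S : {set T}) (i j : 'I_n.+1) : D S -> (i < j)%N -> x j \in S -> x i \in S.
  by move=> /forallP/(_ i)/forallP/(_ j)/implyP H /H/implyP.
apply/eqP; rewrite eq_le visits_ge0 ?set11// andbT.
apply: (@cover_max_principle _ _ c c_ge0 c_conn D F); last exact: set11.
- move=> S b b' DS bS; rewrite cE => bb'; apply/forallP => i; apply/forallP => j.
  apply/implyP => ij; apply/implyP; rewrite !in_setU1 => /orP[/eqP xj|xj]; last first.
    by rewrite (DP S i j)// orbT.
  apply/orP; right; move: bb'; rewrite -xj -(ixK b) xE => /orP[] /eqP jk.
    have ik : (i <= xi b)%N by rewrite -ltnS -jk.
    move: ik; rewrite leq_eqVlt => /orP[/eqP/val_inj ->|ik]; first by rewrite ixK.
    by apply: (DP S i (xi b)) => //; rewrite ixK.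
  apply: (DP S i (xi b)) => //; first by rewrite jk ltnS ltnW.
  by rewrite ixK.
- move=> S b DS bS; have [->|ST] := eqVneq S setT; first by left; rewrite FT.
  (* The source sits at [w], the last vertex of the path; an initial segment containing it is
     full. *)
  right; split=> //; rewrite FL// (_ : (b == w) = false) ?mulr0//.
  apply/eqP => bw; case/negP: ST; apply/eqP/setP => y; rewrite inE -(ixK y).
  have [->|yn] := eqVneq (xi y) ord_max; first by rewrite xn -bw.
  apply: (DP S _ ord_max) => //; last by rewrite xn -bw.
  by rewrite ltn_neqAle yn /= -ltnS.
- apply/forallP => i; apply/forallP => j; apply/implyP => ij; apply/implyP.
  rewrite inE -x0 => /eqP /(can_inj xiK) j0.
  by move: ij; rewrite j0.
Qed.

End VisitsVanish.

(** * Translation of the path criterion back to G *)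

Section Fork.
Import boot.fintype boot.finset.
Context (V : finType) (e : rel V).
Hypothesis e_sym : symmetric e.
Hypothesis e_irr : irreflexive e.
Hypothesis e_conn : forall x y : V, connect e x y.
Context (u v : V).
Hypothesis uv_neq : u != v.
Hypothesis uv_nonadj : ~~ e u v.

Local Notation W := (identified u v).
Local Notation g := (identify u v).
Local Notation w := (merged u v).
Local Notation E := (@underlying_simple V e u v).

Lemma underlying_simpleE (a b : W) :
  E a b = [exists x, exists y, [&& e x y, g x == a & g y == b]].
Proof.
apply/andP/existsP => [[_ /card_gt0P[[x y]]]|[x /existsP[y /and3P[xy /eqP <- /eqP <-]]]].
  by rewrite inE /= => H; exists x; apply/existsP; exists y.
by rewrite (edge_identify_neq e_sym e_irr uv_nonadj xy) multiplicity_gt0.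
Qed.

Lemma underlying_simple_sym : symmetric E.
Proof.
move=> a b; rewrite !underlying_simpleE.
by apply/existsP/existsP => -[x /existsP[y /and3P[xy xa yb]]];
  exists y; apply/existsP; exists x; rewrite e_sym xy xa yb.
Qed.

Lemma underlying_simple_irr : irreflexive E.
Proof. by move=> a; rewrite /underlying_simple eqxx. Qed.

Lemma underlying_simple_gt0 (a b : W) : E a b = (0 < multiplicity e a b)%N.
Proof.
apply/idP/idP => [/andP[]//|/card_gt0P[[x y]]]; rewrite inE /= => /and3P[xy xa yb].
by rewrite underlying_simpleE; apply/existsP; exists x; apply/existsP; exists y;
  rewrite xy xa.
Qed.

Lemma underlying_simple_inner x y : x \notin [:: u; v] -> y \notin [:: u; v] ->
  E (g x) (g y) = e x y.
Proof.
move=> xuv yuv; rewrite underlying_simpleE; apply/existsP/idP => [[x' /existsP[y']]|xy].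
  by rewrite !identify_eq// => /and3P[x'y' /eqP <- /eqP <-].
by exists x; apply/existsP; exists y; rewrite xy !eqxx.
Qed.

Lemma underlying_simple_merged x : x \notin [:: u; v] ->
  E (g x) w = e x u || e x v.
Proof.
move=> xuv; rewrite underlying_simpleE; apply/existsP/orP => [[x' /existsP[y']]|xy].
  rewrite identify_eq// identify_eq_merged !inE => /and3P[x'y' /eqP <- /orP[] /eqP <-];
  by [left|right].
by exists x; apply/existsP; case: xy => xy; [exists u|exists v];
  rewrite xy eqxx identify_eq_merged !inE eqxx ?orbT.
Qed.

Lemma mem_edge_set a b : ([set a; b] \in edge_set e) = e a b.
Proof.
apply/imsetP/idP => [[[x y]]|ab]; last by exists (a, b); rewrite ?inE.
rewrite inE /= => xy /eqP.
have xny : x != y by apply: contraTneq xy => ->; rewrite e_irr.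
by rewrite eq_set2_uv// => /orP[] /andP[/eqP -> /eqP ->]//; rewrite e_sym.
Qed.

Section Tail.
Context (L : nat) (x : nat -> V).
Hypothesis x_uniq : uniq [:: u, v & mkseq x L.+1].
Hypothesis x_cover : [set: V] = [set x i | i : 'I_L.+1] :|: [set u; v].

Lemma tail_uniq : [/\ u \notin v :: mkseq x L.+1, v \notin mkseq x L.+1 &
  uniq (mkseq x L.+1)].
Proof. by move: x_uniq; rewrite 2!cons_uniq => /and3P. Qed.

Lemma tail_inj i j : (i <= L)%N -> (j <= L)%N -> x i = x j -> i = j.
Proof.
by case: tail_uniq => _ _ /mkseq_uniqP xi iL jL; apply: xi; rewrite inE ltnS.
Qed.

Lemma tail_notin i : (i <= L)%N -> x i \notin [:: u; v].
Proof.
move=> iL; have xm : x i \in mkseq x L.+1 by apply: map_f; rewrite mem_iota.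
case: tail_uniq; rewrite inE !inE => /norP[_ un] vn _.
apply/norP; split; [apply: contra un|apply: contra vn] => /eqP <- //.
Qed.

Lemma tail_cover z : z \notin [:: u; v] -> exists2 i, (i <= L)%N & z = x i.
Proof.
move=> zuv; have : z \in [set: V] by rewrite inE.
rewrite x_cover inE => /orP[/imsetP[i _ ->]|]; first by exists i; rewrite // -ltnS.
by move: zuv; rewrite !inE => /negbTE ->.
Qed.

(** Adjacency form of the edge set in the statement; pairs inside {u, v} are left to non-adjacency
    and irreflexivity. *)
Definition fork : Prop :=
  (forall i j, (i <= L)%N -> (j <= L)%N -> e (x i) (x j) = (j == i.+1) || (i == j.+1)) /\
  (forall i z, (i <= L)%N -> z \in [:: u; v] -> e (x i) z = (i == L)).

Lemma fork_edge_set : fork <->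
  edge_set e = [set [set x i; x i.+1] | i : 'I_L] :|: [set [set x L; u]; [set x L; v]].
Proof.
have tail_neq i : (i <= L)%N -> (x i != u) && (x i != v).
  by move/tail_notin; rewrite !inE negb_or.
split=> [[xx xz]|E_fork].
  apply/setP => A; apply/idP/idP => [/imsetP[[a b]]|].
    rewrite inE /= => ab ->; rewrite !inE.
    have [auv|/tail_cover[i iL ai]] := boolP (a \in [:: u; v]).
      have [buv|/tail_cover[j jL bj]] := boolP (b \in [:: u; v]).
        have := edge_identify_neq e_sym e_irr uv_nonadj ab.
        have /eqP -> : g a == w by rewrite identify_eq_merged.
        have /eqP -> : g b == w by rewrite identify_eq_merged.
        by rewrite eqxx.
      move: ab; rewrite e_sym bj xz// => /eqP ->; rewrite setUC.
      by move: auv; rewrite !inE => /orP[] /eqP ->; rewrite eqxx ?orbT.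
    have [buv|/tail_cover[j jL bj]] := boolP (b \in [:: u; v]).
      move: ab; rewrite ai xz// => /eqP ->.
      by move: buv; rewrite !inE => /orP[] /eqP ->; rewrite eqxx ?orbT.
    move: ab; rewrite ai bj xx// => /orP[] /eqP ij; apply/orP; left; apply/imsetP.
      have iL' : (i < L)%N by rewrite -ij.
      by exists (Ordinal iL') => //=; rewrite ij.
    have jL' : (j < L)%N by rewrite -ij.
    by exists (Ordinal jL') => //=; rewrite ij setUC.
  rewrite !inE => /or3P[/imsetP[i _ ->]|/eqP ->|/eqP ->]; rewrite mem_edge_set.
  - by rewrite xx ?eqxx//; exact: ltnW.
  - by rewrite xz ?eqxx// inE eqxx.
  - by rewrite xz ?eqxx// !inE eqxx orbT.
split=> [i j iL jL|i z iL zuv]; rewrite -mem_edge_set E_fork !inE.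
  have /andP[iu iv] := tail_neq i iL; have /andP[ju jv] := tail_neq j jL.
  have /andP[Lu Lv] := tail_neq L (leqnn L).
  rewrite !eq_set2_uv// (negbTE iu) (negbTE iv) (negbTE ju) (negbTE jv) !andbF !orbF.
  apply/imsetP/orP => [[k _]|].
    have kL : (k <= L)%N by exact: ltnW.
    move/eqP; rewrite eq_set2_uv; last first.
      by apply/eqP => /(tail_inj kL (ltn_ord k)) /eqP; rewrite eqn_leq ltnn andbF.
    by case/orP => /andP[/eqP/tail_inj -> // /eqP/tail_inj -> //];
      rewrite eqxx; [left|right].
  case=> /eqP ij.
    have iL' : (i < L)%N by rewrite -ij.
    by exists (Ordinal iL') => //=; rewrite ij.
  have jL' : (j < L)%N by rewrite -ij.
  by exists (Ordinal jL') => //=; rewrite ij setUC.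
have /andP[iu iv] := tail_neq i iL; have /andP[Lu Lv] := tail_neq L (leqnn L).
rewrite !eq_set2_uv// (negbTE iu) (negbTE iv) !orbF /=.
have -> : ([set x i; z] \in [set [set x k; x k.+1] | k : 'I_L]) = false.
  apply/imsetP => -[k _] /eqP; have kL : (k <= L)%N by exact: ltnW.
  have zx k' : (k' <= L)%N -> (z == x k') = false.
    by move/tail_notin => kn; apply: contraNF kn => /eqP <-.
  rewrite eq_set2_uv ?zx ?andbF//.
  by apply/eqP => /(tail_inj kL (ltn_ord k)) /eqP; rewrite eqn_leq ltnn andbF.
move: zuv; rewrite !inE /= -andb_orr => ->; rewrite andbT.
by apply/eqP/eqP => [/tail_inj ->|->].
Qed.

End Tail.

(** The path in G/uv has distinct ends, hence [L.+1] edges, and its last vertex is the merged one.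
    Removing that vertex leaves the tail [x 0], ..., [x L], and [u] and [v] can only be attached at
    [x L]. *)
Lemma path_graph_fork s : s \notin [:: u; v] ->
  path_graph_between E (g s) w <->
  exists (L : nat) (x : nat -> V),
    [/\ uniq [:: u, v & mkseq x L.+1],
        [set: V] = [set x i | i : 'I_L.+1] :|: [set u; v], s = x 0%N & fork L x].
Proof.
move=> suv; have sw : g s != w by rewrite identify_eq_merged.
split.
  case=> -[|L] [xb [[bx xbK bxK] xb0 xbn xbE]].
    by case/eqP: sw; rewrite -xb0 -xbn; congr xb; exact: val_inj.
  (* A preimage under [g], unique for [i <= L]; by surjectivity of [g] the default [s] is never
     taken. *)
  pose x i := odflt s [pick y | g y == xb (inord i)].
  have gx i : g (x i) = xb (inord i).
    rewrite /x; case: pickP => [y /eqP//|/=].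
    by have [y <-] := identify_surj (xb (inord i)) => /(_ y); rewrite eqxx.
  have xuv i : (i <= L)%N -> x i \notin [:: u; v].
    move=> iL; rewrite -identify_eq_merged gx -xbn (can_eq xbK).
    by apply/eqP => /(congr1 val) /=; rewrite inordK; lia.
  have xinj i j : (i <= L)%N -> (j <= L)%N -> x i = x j -> i = j.
    move=> iL jL /(congr1 g); rewrite !gx => /(can_inj xbK) /(congr1 val) /=.
    by rewrite !inordK //; lia.
  have xcov z : z \notin [:: u; v] -> exists2 i, (i <= L)%N & z = x i.
    move=> zuv; have zL : (bx (g z) <= L)%N.
      rewrite -ltnS ltn_neqAle -ltnS ltn_ord andbT.
      apply: contra zuv => /eqP zL; rewrite -identify_eq_merged -xbn -(bxK (g z)).
      by apply/eqP; congr xb; exact: val_inj.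
    exists (bx (g z)) => //; apply/esym/eqP.
    by rewrite -(@identify_eq _ u v z)// gx inord_val bxK.
  exists L, x; split.
  - rewrite 2!cons_uniq inE negb_or uv_neq.
    have H z : z \in [:: u; v] -> z \notin mkseq x L.+1.
      move=> zuv; apply/mapP => -[i]; rewrite mem_iota => /andP[_ iL] zE.
      by have := xuv i iL; rewrite -zE zuv.
    rewrite !H ?inE ?eqxx ?orbT// !andTb; apply/mkseq_uniqP => i j; rewrite !inE !ltnS.
    exact: xinj.
  - apply/setP => z; rewrite !inE; apply/esym.
    have [//|] := boolP (z \in [:: u; v]).
      by rewrite !inE => ->; rewrite orbT.
    move=> /xcov[i iL ->]; apply/orP; left; apply/imsetP.
    by exists (inord i) => //; rewrite inordK.
  - apply/esym/eqP; rewrite -(@identify_eq _ u v s)// gx -xb0; apply/eqP.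
    by congr xb; apply: val_inj; rewrite /= inordK.
  have fork1 i j : (i <= L)%N -> (j <= L)%N ->
      e (x i) (x j) = (j == i.+1) || (i == j.+1).
    move=> iL jL; rewrite -underlying_simple_inner ?xuv// !gx xbE.
    by rewrite !inordK// ltnW.
  have merged_adj i : (i <= L)%N -> e (x i) u || e (x i) v = (i == L).
    move=> iL; rewrite -underlying_simple_merged ?xuv// gx -xbn xbE /=.
    by rewrite inordK; lia.
  split=> // i z iL zuv; apply/idP/eqP => [xz|->].
    apply/eqP; rewrite -merged_adj//.
    by move: zuv xz; rewrite !inE => /orP[] /eqP -> ->; rewrite ?orbT.
  (* [merged_adj] only says that one of [u] and [v] is adjacent to [x L]. By connectedness each of
     them has some neighbour, and this can only be [x L]. *)
  have [y zy] := neighbour_exists e_conn uv_neq z.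
  have yuv : y \notin [:: u; v].
    rewrite -identify_eq_merged; have /eqP <- : g z == w by rewrite identify_eq_merged.
    by rewrite eq_sym; exact: (edge_identify_neq e_sym e_irr uv_nonadj zy).
  have [j jL yj] := xcov y yuv; rewrite e_sym yj in zy.
  have /eqP <- // : j == L.
  rewrite -merged_adj//; move: zuv zy; rewrite !inE => /orP[] /eqP -> ->; rewrite ?orbT//.
case=> L [x [x_uniq x_cover s0 [xx xz]]].
have xuv := tail_notin x_uniq; have xinj := tail_inj x_uniq.
pose xb (i : 'I_L.+2) : W := if (i <= L)%N then g (x i) else w.
have xb_inj : injective xb.
  move=> i j; rewrite /xb; case: ifPn => iL; case: ifPn => jL.
  - by move/eqP; rewrite identify_eq ?xuv// => /eqP/xinj ij; apply/val_inj/ij.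
  - by move/eqP; rewrite identify_eq_merged (negbTE (xuv _ iL)).
  - by move/esym/eqP; rewrite identify_eq_merged (negbTE (xuv _ jL)).
  - by move=> _; apply: val_inj => /=; have := ltn_ord i; have := ltn_ord j; lia.
have xb_surj a : exists i, xb i = a.
  have [z <-] := identify_surj a.
  have [zuv|/(tail_cover x_cover)[i iL ->]] := boolP (z \in [:: u; v]).
    exists ord_max; rewrite /xb /= ltnn; apply/esym/eqP.
    by rewrite identify_eq_merged.
  by exists (inord i); rewrite /xb inordK ?iL// ltnW.
exists L.+1, xb; split.
- exists (fun a => odflt ord0 [pick i | xb i == a]).
    by move=> i; case: pickP => [j /eqP/xb_inj//|/(_ i)]; rewrite eqxx.
  move=> a; case: pickP => [j /eqP//|/=]; have [i <-] := xb_surj a.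
  by move/(_ i); rewrite eqxx.
- by rewrite /xb /= s0.
- by rewrite /xb /= ltnn.
have xbw i : (i <= L)%N -> E (g (x i)) w = (i == L).
  move=> iL; rewrite underlying_simple_merged ?xuv// !xz ?inE ?eqxx ?orbT//.
  by rewrite orbb.
move=> i j; have := ltn_ord i; have := ltn_ord j.
rewrite /xb; case: ifPn => iL; case: ifPn => jL ? ?.
- by rewrite underlying_simple_inner ?xuv// xx.
- rewrite xbw//; lia.
- rewrite underlying_simple_sym xbw//; lia.
- rewrite underlying_simple_irr; lia.
Qed.

End Fork.

(** * The limit of the slope and the conclusion *)

Local Open Scope classical_set_scope.
Local Open Scope ring_scope.

(** A bounded deviation from [lam * l], together with the fixed value at 0, disappears after
    division by [lam]. *)
Lemma cvg_slope_pinfty (R : realType) (f : R -> \bar R) (H : R -> R) (C L l : R) :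
  (forall lam : R, 0 <= lam -> f lam = (H lam)%:E) ->
  (forall lam : R, 0 <= lam -> L <= lam -> `|H lam - lam * l| <= C) ->
  ((f lam - f 0%R) * (lam^-1)%:E)%E @[lam --> +oo] --> l%:E.
Proof.
move=> fH HC; have slopeE (lam : R) : 0 <= lam ->
    ((f lam - f 0%R) * (lam^-1)%:E = ((H lam - H 0) / lam)%:E)%E.
  by move=> lam0; rewrite !fH.
apply: cvg_EFin.
  by near=> lam; rewrite slopeE//.
apply/cvgrPdist_le => /= eps eps0; near=> lam.
have lam0 : 0 < lam by near: lam; apply: nbhs_pinfty_gt; exact: num_real.
rewrite /= (slopeE _ (ltW lam0)) /=.
have := HC lam (ltW lam0); have /[swap] /[apply] : L <= lam.
  by near: lam; apply: nbhs_pinfty_ge; exact: num_real.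
move=> Hl; rewrite -(ler_pM2r lam0) -[X in _ * X <= _](gtr0_norm lam0) -normrM.
rewrite mulrBl divfK ?gt_eqF//.
(* Beyond this threshold the total error, [C] plus the norm of [H 0], is at most [eps * lam]. *)
have : (C + `|H 0|) / eps <= lam by near: lam; apply: nbhs_pinfty_ge; exact: num_real.
rewrite ler_pdivrMr// mulrC => big.
apply: le_trans big.
rewrite -normrN.
rewrite (_ : - (l * lam - (H lam - H 0)) = (H lam - lam * l) - H 0); last by ring.
by apply: le_trans (ler_normB _ _) _; rewrite lerD2r.
Unshelve. all: by end_near. Qed.

Theorem theorem4p4 (R : realType) (V : finType) (e : rel V)
  (e_sym : symmetric e) (e_irr : irreflexive e)
  (e_conn : forall x y : V, connect e x y)
  (u v : V) (uv_neq : u != v) (uv_nonadj : ~~ e u v) (s : V)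
  (* (X lam) is the walk on G with the extra edge uv of conductance lam *)
  (d : R -> measure_display) (Om : forall lam : R, measurableType (d lam))
  (P : forall lam : R, probability (Om lam) R)
  (X : forall lam : R, nat -> Om lam -> V)
  (X_walk : forall lam : R, 0 <= lam ->
     random_walk (P lam) (conductance e u v lam) s (X lam))
  (* Y is the walk on G/uv *)
  (d' : measure_display) (Om' : measurableType d') (Q : probability Om' R)
  (Y : nat -> Om' -> identified u v)
  (Y_walk : random_walk Q (fun a b => (multiplicity e a b)%:R)
     (identify u v s) Y) :
  let f (lam : R) : \bar R := (\int[P lam]_om cover_time R (X lam) om)%E in
  let EL : \bar R :=
    (\int[Q]_om visits_before_cover R Y (merged u v) om)%E in
  exists l : R,
    [/\ ((f lam - f 0%R) * (lam^-1)%:E)%E @[lam --> +oo] --> l%:E,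
        (l%:E = (2 / (degree e u + degree e v)%:R)%:E * EL)%E,
        0 <= l &
        [/\ (s \in [:: u; v] -> 0 < l),
            (s \notin [:: u; v] ->
               (l = 0 <->
                path_graph_between (@underlying_simple V e u v)
                  (identify u v s) (merged u v))) &
            (l = 0 <->
             exists (L : nat) (x : nat -> V),
               [/\ uniq [:: u, v & mkseq x L.+1],
                   [set: V]%SET = ([set x i | i : 'I_L.+1] :|: [set u; v])%SET,
                   s = x 0%N &
                   edge_set e =
                     ([set [set x i; x i.+1] | i : 'I_L]
                       :|: [set [set x L; u]; [set x L; v]])%SET])]].

Proof.
move=> f EL.
pose g := identify u v; pose w := merged u v.
pose m := fun a b : identified u v => (multiplicity e a b)%:R : R.
have m_ge0 a b : 0 <= m a b by exact: ler0n.
have m_conn a b : connect (fun a b => 0 < m a b) a b by exact: multiplicity_conn.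
have m_gt0 a : 0 < \sum_b m a b by exact: sum_multiplicity_gt0.
have mE a b : (0 < m a b) = underlying_simple e a b.
  by rewrite ltr0n -underlying_simple_gt0.
have E_sym := underlying_simple_sym e_sym e_irr uv_nonadj.
have E_irr := @underlying_simple_irr _ e u v.
pose D : R := (degree e u + degree e v)%:R.
have mD : \sum_b m w b = D by exact: sum_multiplicity_merged.
have D0 : 0 < D by rewrite -mD.
have [k [kT kL]] := cover_solution_exists m_ge0 m_conn
  (fun _ a => (\sum_b m a b) * (a == w)%:R).
have ELk : EL = (k [set g s]%SET (g s))%:E.
  exact: (expected_visits_before_cover Y_walk).
have gsT : [set w]%SET != [set: identified u v]%SET.
  have [y uy] := neighbour_exists e_conn uv_neq u.
  apply/eqP => /setP/(_ (g y)); rewrite !inE => /eqP gy.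
  have := edge_identify_neq e_sym e_irr uv_nonadj uy.
  by rewrite identify_u -/g gy eqxx.
(* The total multiplicity at the merged vertex is [D], so this factor makes the Laplacian there
   equal to 2, one unit for each of [u] and [v]. *)
pose K S a := 2 / D * k S a.
have [||C [L HC]] := @cover_asymptotics R V e e_conn u v uv_neq K.
- by move=> a; rewrite /K kT mulr0.
- move=> S a ST aS; rewrite /K cover_laplacianZ kL//.
  case: eqP => [->|_]; last by rewrite !mulr0.
  by rewrite mD !mulr1 divfK ?gt_eqF.
pose l := K [set g s]%SET (g s).
(* The solution [h] depends on [lam], whereas [C] and [L] are already fixed. *)
have fh lam : 0 <= lam -> exists2 h : {set V} -> V -> R,
    f lam = (h [set s]%SET s)%:E & L <= lam -> `|h [set s]%SET s - lam * l| <= C.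
  move=> lam0; have c_ge0 := conductance_ge0 e u v lam0.
  have c_conn := conductance_conn e_conn u v lam0.
  have c_gt0 := sum_conductance_gt0 e_conn uv_neq lam0.
  have [h [hT hL]] := cover_solution_exists c_ge0 c_conn
    (fun _ x => \sum_y conductance e u v lam x y).
  exists h; first exact: (expected_cover_time (X_walk _ lam0) c_ge0 c_conn c_gt0 hT hL).
  move=> Llam; have := HC lam h Llam hT hL [set s]%SET s (set11 s).
  by rewrite imset_set1.
have l0 : (l = 0) <-> (k [set g s]%SET (g s) = 0).
  rewrite /l /K; split=> [/eqP|->]; last by rewrite mulr0.
  by rewrite mulf_eq0 gt_eqF ?divr_gt0//= => /eqP.
have l_ge0 : 0 <= l.
  rewrite mulr_ge0 ?divr_ge0 ?(ltW D0)//.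
  by apply: (visits_ge0 m_ge0 m_conn m_gt0 kT kL); exact: set11.
have l_pos : s \in [:: u; v] -> 0 < l.
  rewrite -identify_eq_merged => /eqP gs; rewrite lt_def l_ge0 andbT.
  apply/eqP => /l0; rewrite /g gs => k0.
  by have := visits_start_gt0 m_ge0 m_conn m_gt0 mE kT kL gsT; rewrite k0 ltxx.
have l_path : s \notin [:: u; v] -> l = 0 <->
    path_graph_between (@underlying_simple V e u v) (g s) w.
  move=> suv; apply: iff_trans l0 _.
  apply: (visits_eq0P m_ge0 m_conn m_gt0 mE E_sym E_irr kT kL).
  by rewrite identify_eq_merged.
exists l; split=> //.
- apply: (@cvg_slope_pinfty _ f (fun lam => fine (f lam)) C L) => lam lam0.
    by have [h ->] := fh lam lam0.
  by have [h -> /=] := fh lam lam0.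
- by rewrite ELk.
split=> //.
(* For [s] in {u, v} both sides are false: [l] is positive, and the tail avoids [u] and [v]. *)
have [suv|suv] := boolP (s \in [:: u; v]).
  split=> [l00|[L' [x [xU _ s0 _]]]]; first by have := l_pos suv; rewrite l00 ltxx.
  by have := tail_notin xU (leq0n L'); rewrite -s0 suv.
apply: iff_trans (l_path suv) _.
apply: iff_trans (path_graph_fork e_sym e_irr e_conn uv_neq uv_nonadj suv) _.
by split=> -[L' [x [xU xC s0 xF]]]; exists L', x; split=> //;
  apply/(fork_edge_set e_sym e_irr uv_nonadj xU xC).
Qed.
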